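(* Let $G\le \mathrm{O}(d)$ be a group of orthogonal linear maps of $\mathbb{R}^d$ (not assumed closed). (a) If some orbit of $G$ is not a closed subset of $\mathbb{R}^d$, then every continuous map from $\mathbb{R}^d/G$ (with the quotient topology) to any $T_1$ topological space fails to be injective. (b) If the orbits of $G$ are the concentric spheres $\{x\in\mathbb{R}^d:\|x\|=r\}$, $r\ge 0$, centered at the origin, then for every nonzero $z\in\mathbb{R}^d$ the map $\mathbb{R}^d/G\to\mathbb{R}$, $[x]\mapsto\langle\!\langle [z],[x]\rangle\!\rangle$, is injective. (c) If every orbit of $G$ is closed and $n\ge 2d$, then for generic $(z_1,\ldots,z_n)\in(\mathbb{R}^d)^n$ the max filter bank $\mathbb{R}^d/G\to\mathbb{R}^n$, $[x]\mapsto(\langle\!\langle [z_i],[x]\rangle\!\rangle)_{i=1}^n$, is injective.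
   Context: For $x\in\mathbb{R}^d$, $[x]:=\{gx:g\in G\}$ denotes its orbit and $\mathbb{R}^d/G$ the set of orbits. The max filtering map is $\langle\!\langle [x],[y]\rangle\!\rangle:=\sup_{p\in[x],\,q\in[y]}\langle p,q\rangle$ (standard inner product). ''Generic'' means: the property holds for all $(z_1,\ldots,z_n)$ outside a subset of $(\mathbb{R}^d)^n\cong\mathbb{R}^{dn}$ contained in a semialgebraic set of dimension strictly less than $dn$ (in particular a closed Lebesgue-null set). *)

(* Defs.v *)
From HB Require Import structures.
From mathcomp Require Import all_boot all_order all_algebra.
From mathcomp Require Import all_classical all_reals all_analysis.
Set Implicit Arguments. Unset Strict Implicit. Unset Printing Implicit Defensive.
Import Order.TTheory GRing.Theory Num.Theory.
Import numFieldNormedType.Exports.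
Local Open Scope classical_set_scope.
Local Open Scope ring_scope.

Definition inner (R : realType) (d : nat) (x y : 'cV[R]_d) : R :=
  \sum_(i < d) x i 0 * y i 0.

Definition orthogonal_mx (R : realType) (d : nat) (M : 'M[R]_d) : Prop :=
  M *m M^T = 1%:M.

Definition orth_group (R : realType) (d : nat) (G : set 'M[R]_d) : Prop :=
  [/\ (forall g, G g -> orthogonal_mx g),
      G 1%:M,
      (forall g h, G g -> G h -> G (g *m h)) &
      (forall g, G g -> G (invmx g))].

Definition gorbit (R : realType) (d : nat) (G : set 'M[R]_d) (x : 'cV[R]_d)
  : set 'cV[R]_d := [set g *m x | g in G].

Definition maxfilt (R : realType) (d : nat) (G : set 'M[R]_d)
  (x y : 'cV[R]_d) : R :=
  sup [set inner p q | p in gorbit G x & q in gorbit G y].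

Inductive pexpr (R : Type) (I : Type) : Type :=
| PConst of R
| PVar of I
| PAdd of pexpr R I & pexpr R I
| PMul of pexpr R I & pexpr R I.

Fixpoint peval (R : realType) (I : Type) (x : I -> R) (p : pexpr R I) : R :=
  match p with
  | PConst c => c
  | PVar i => x i
  | PAdd p q => peval x p + peval x q
  | PMul p q => peval x p * peval x q
  end.

Inductive semialgebraic (R : realType) (I : Type) : set (I -> R) -> Prop :=
| SA_pos (p : pexpr R I) : semialgebraic [set x | 0 < peval x p]
| SA_zero (p : pexpr R I) : semialgebraic [set x | peval x p = 0]
| SA_union (A B : set (I -> R)) :
    semialgebraic A -> semialgebraic B -> semialgebraic (A `|` B)
| SA_compl (A : set (I -> R)) : semialgebraic A -> semialgebraic (~` A).

Definition proj_has_interior (R : realType) (I : finType)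
  (S : set (I -> R)) (J : {set I}) : Prop :=
  exists x : I -> R, exists2 e : R, 0 < e &
    forall y : I -> R, (forall i, i \in J -> `|y i - x i| < e) ->
      exists2 s, S s & forall i, i \in J -> s i = y i.

(* dim S < k, where the dimension of a semialgebraic set S is the largest
   #|J| such that the coordinate projection of S onto R^J has nonempty
   interior *)
Definition dim_lt (R : realType) (I : finType) (S : set (I -> R)) (k : nat)
  : Prop :=
  forall J : {set I}, (k <= #|J|)%N -> ~ proj_has_interior S J.

(* (R^d)^n = R^{dn}: a tuple (z_1,...,z_n) is an n x d matrix whose i-th
   row is z_i; its coordinates are indexed by 'I_n * 'I_d *)
Definition mx_coords (R : realType) (n d : nat) (f : 'I_n * 'I_d -> R)
  : 'M[R]_(n, d) := \matrix_(i, j) f (i, j).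

Definition generic (R : realType) (n d : nat) (P : 'M[R]_(n, d) -> Prop)
  : Prop :=
  exists S : set ('I_n * 'I_d -> R),
    [/\ semialgebraic S, dim_lt S (n * d) &
        forall f, ~ S f -> P (mx_coords f)].

Definition zvec (R : realType) (n d : nat) (Z : 'M[R]_(n, d)) (i : 'I_n)
  : 'cV[R]_d := (row i Z)^T.

(* Main.v *)
Require Import Defs.
From HB Require Import structures.
From mathcomp Require Import all_boot all_order all_algebra.
From mathcomp Require Import all_classical all_reals all_analysis.
From mathcomp Require Import zify ring lra.
From mathcomp Require ordered_qelim qe_rcf.
Set Implicit Arguments. Unset Strict Implicit. Unset Printing Implicit Defensive.
Import Order.TTheory GRing.Theory Num.Theory.
Import numFieldNormedType.Exports.
Local Open Scope classical_set_scope.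
Local Open Scope ring_scope.

(** (a) and (b) are direct: a closed fibre containing an orbit contains its
    closure, and on spheres the max filter is |z||x|.

    For (c), the set of the (z_1, ..., z_n) that confuse two distinct orbits is
    itself semialgebraic with empty interior, hence of dimension < dn.

    Semialgebraic: by Tarski-Seidenberg it is enough that "x and y lie on the
    same orbit" is a semialgebraic relation. Disjoint closed orbits are
    separated by an invariant polynomial, and by Hilbert's basis theorem
    finitely many invariant polynomials suffice.

    Empty interior: by Baire's theorem it is enough to treat the pairs (x, y)
    whose orbits are at distance at least e, normalized to the unit sphere of
    the sup norm, which has dimension 2d - 1. For a fixed pair, the difference
    of the two max filters is a difference of convex functions with
    subgradients of norm at least e, so it is O(1/N) at only O(N^(d-1)) of the
    N^d points of a grid of mesh 1/N. Hence only
    O(N^(2d-1) N^(n(d-1))) = o(N^(nd)) grid points are confused up to O(1/N). *)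

(** * Inner product, orthogonal groups and orbits *)

Section Inner.
Variables (R : realType) (d : nat).
Implicit Types (x y z : 'cV[R]_d) (g h : 'M[R]_d).

Lemma innerC x y : inner x y = inner y x.
Proof. by apply: eq_bigr => i _; rewrite mulrC. Qed.

Lemma innerDr x y z : inner x (y + z) = inner x y + inner x z.
Proof. by rewrite -big_split; apply: eq_bigr => i _; rewrite mxE mulrDr. Qed.

Lemma innerZr (a : R) x y : inner x (a *: y) = a * inner x y.
Proof. by rewrite mulr_sumr; apply: eq_bigr => i _; rewrite mxE mulrCA. Qed.

Lemma innerBr x y z : inner x (y - z) = inner x y - inner x z.
Proof. by rewrite innerDr -scaleN1r innerZr mulN1r. Qed.

Lemma innerDl x y z : inner (x + y) z = inner x z + inner y z.
Proof. by rewrite innerC innerDr !(innerC z). Qed.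

Lemma innerZl (a : R) x y : inner (a *: x) y = a * inner x y.
Proof. by rewrite innerC innerZr innerC. Qed.

Lemma innerBl x y z : inner (x - y) z = inner x z - inner y z.
Proof. by rewrite innerC innerBr !(innerC z). Qed.

Lemma inner_ge0 x : 0 <= inner x x.
Proof. by apply: sumr_ge0 => i _; rewrite -expr2 sqr_ge0. Qed.

Lemma sqr_coord_le_inner x i : x i 0 ^+ 2 <= inner x x.
Proof.
rewrite /inner (bigD1 i) //= -expr2 lerDl.
by apply: sumr_ge0 => j _; rewrite -expr2 sqr_ge0.
Qed.

Lemma inner_eq0 x : inner x x = 0 -> x = 0.
Proof.
move=> x0; apply/matrixP => i j; rewrite ord1 mxE.
by have := sqr_coord_le_inner x i; rewrite x0 real_exprn_even_le0 ?num_real //= => /eqP.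
Qed.

Lemma inner_gt0 x : x != 0 -> 0 < inner x x.
Proof.
move=> x0; rewrite lt_neqAle inner_ge0 andbT eq_sym.
by apply: contra x0 => /eqP/inner_eq0 ->.
Qed.

Lemma CauchySchwarz_inner x y : inner x y ^+ 2 <= inner x x * inner y y.
Proof.
have [->|y0] := eqVneq y 0.
  have -> : 0 = 0 *: x :> 'cV[R]_d by rewrite scale0r.
  by rewrite !innerZr !mul0r mulr0 expr0n.
have yy := inner_gt0 y0.
(* Up to the factor [inner y y], this vector is the component of [x] orthogonal to [y]; clearing the
   denominator avoids a division. *)
have := inner_ge0 (inner y y *: x - inner x y *: y).
rewrite !(innerBl, innerBr, innerZl, innerZr) (innerC y x).
set a := inner x x; set b := inner y y; set c := inner x y.
set e := (X in 0 <= X); have -> : e = b * (a * b - c ^+ 2) by rewrite /e; ring.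
by rewrite pmulr_rge0 // subr_ge0.
Qed.

Lemma normr_inner_le (a b : R) x y : 0 <= a -> 0 <= b ->
  inner x x <= a ^+ 2 -> inner y y <= b ^+ 2 -> `|inner x y| <= a * b.
Proof.
move=> a0 b0 xa yb; rewrite -(@ler_pXn2r _ 2) ?nnegrE ?mulr_ge0 // real_normK ?num_real //.
rewrite (le_trans (CauchySchwarz_inner _ _)) // exprMn ler_pM ?inner_ge0 //.
Qed.

(** The crude constant [d] in place of its square root keeps the later estimates free of roots. *)
Lemma inner_le_coords x (k : R) : 0 <= k -> (forall i, `|x i 0| <= k) ->
  inner x x <= (d%:R * k) ^+ 2.
Proof.
move=> k0 xk; apply: (@le_trans _ _ (d%:R * k ^+ 2)).
  rewrite mulr_natl -[X in _ *+ X]card_ord -sumr_const.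
  apply: ler_sum => i _; rewrite -expr2 -[leLHS]real_normK ?num_real //.
  by rewrite lerXn2r ?nnegrE.
rewrite exprMn ler_wpM2r ?sqr_ge0 // -natrX ler_nat.
by case: d => // d'; rewrite expnS leq_pmulr // expn_gt0.
Qed.

Lemma coord_le_inner x (k : R) i : 0 <= k -> inner x x <= k ^+ 2 -> `|x i 0| <= k.
Proof.
move=> k0 xk; rewrite -(@ler_pXn2r _ 2) ?nnegrE // real_normK ?num_real //.
exact: le_trans (sqr_coord_le_inner _ _) xk.
Qed.

Lemma inner_trmx g x y : inner (g *m x) y = inner x (g^T *m y).
Proof.
have innerE u v : inner u v = (u^T *m v) 0 0.
  by rewrite mxE; apply: eq_bigr => i _; rewrite mxE.
by rewrite !innerE trmx_mul mulmxA.
Qed.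

Lemma orthogonal_trmx_mul g : orthogonal_mx g -> g^T *m g = 1%:M.
Proof. exact: mulmx1C. Qed.

Lemma inner_orthogonal g x y : orthogonal_mx g -> inner (g *m x) (g *m y) = inner x y.
Proof.
by move=> og; rewrite inner_trmx mulmxA orthogonal_trmx_mul // mul1mx.
Qed.

Lemma orth_group_tr (G : set 'M[R]_d) g : orth_group G -> G g -> G g^T.
Proof.
move=> [oG _ _ Ginv] Gg; have og := oG g Gg.
suff -> : g^T = invmx g by exact: Ginv.
have ug : g \in unitmx by have [] := mulmx1_unit og.
by rewrite -[RHS](mulmx1) -og mulmxA mulVmx // mul1mx.
Qed.

Lemma gorbit_refl (G : set 'M[R]_d) x : orth_group G -> gorbit G x x.
Proof. by move=> [_ G1 _ _]; exists 1%:M; rewrite ?mul1mx. Qed.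

Lemma gorbit_eq (G : set 'M[R]_d) x y : orth_group G -> gorbit G x y ->
  gorbit G y = gorbit G x.
Proof.
move=> Gg [g Gg0 <-]; have [oG G1 GM Ginv] := Gg; apply/seteqP; split=> [_ [h Gh <-]|_ [h Gh <-]].
  by exists (h *m g); rewrite ?mulmxA //; apply: GM.
exists (h *m g^T); first by apply: GM => //; apply: orth_group_tr.
by rewrite mulmxA -(mulmxA h) orthogonal_trmx_mul ?mulmx1 //; apply: oG.
Qed.

Lemma inner_gorbit (G : set 'M[R]_d) x y : orth_group G -> gorbit G x y ->
  inner y y = inner x x.
Proof. by move=> [oG _ _ _] [g Gg <-]; rewrite inner_orthogonal //; apply: oG. Qed.

Lemma gorbit_stable (G : set 'M[R]_d) x y g : orth_group G -> G g ->
  gorbit G x y -> gorbit G x (g *m y).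
Proof.
move=> [_ _ GM _] Gg [h Gh <-]; exists (g *m h); rewrite ?mulmxA //; exact: GM.
Qed.

(** A closed orbit missing [x] misses a ball around [x]. Any pair [g *m x], [v] is moved
    isometrically by [g^T] to a pair starting at [x], so the radius of that ball serves for all
    pairs. *)
Lemma gorbit_separated (G : set 'M[R]_d) x y : orth_group G ->
  closed (gorbit G y) -> gorbit G x <> gorbit G y ->
  exists2 e : R, 0 < e &
    forall u v, gorbit G x u -> gorbit G y v -> e ^+ 2 <= inner (u - v) (u - v).
Proof.
move=> Gg cy nxy.
have nyx : ~ gorbit G y x by move=> /(gorbit_eq Gg).
have : nbhs x (~` gorbit G y) by apply: open_nbhs_nbhs; split=> //; exact: closed_openC.
move=> /nbhs_ballP[e /= e0 ball_sub]; exists e => //.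
have [oG _ _ _] := Gg.
move=> _ v [g Ggg <-] yv; rewrite leNgt; apply/negP => lt.
have og := oG g Ggg.
apply: (ball_sub (g^T *m v)); last first.
  exact: gorbit_stable (orth_group_tr Gg Ggg) yv.
have xv : x - g^T *m v = g^T *m (g *m x - v).
  by rewrite mulmxBr mulmxA orthogonal_trmx_mul // mul1mx.
have ogT : orthogonal_mx g^T by rewrite /orthogonal_mx trmxK orthogonal_trmx_mul.
split=> // i j; rewrite ord1 /ball /=.
have -> : x i 0 - (g^T *m v) i 0 = (x - g^T *m v) i 0 by rewrite !mxE.
rewrite -(@ltr_pXn2r _ 2) ?nnegrE // ?(ltW e0) // real_normK ?num_real //.
apply: le_lt_trans (sqr_coord_le_inner _ _) _.
by rewrite xv inner_orthogonal.
Qed.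

End Inner.

(** Discretizes the interval [-M, M] with step [k]. For arguments in that interval the index is in
    range, so [inord] does not fall back on its default. *)
Definition cell (R : realType) (M k : R) (t : R) : 'I_(Num.truncn ((M + M) / k)).+1 :=
  inord (Num.truncn ((t + M) / k)).

Lemma cell_close (R : realType) (M k s t : R) : 0 < k -> `|s| <= M -> `|t| <= M ->
  cell M k s = cell M k t -> `|s - t| <= k.
Proof.
move=> k0; rewrite !ler_norml => /andP[s1 s2] /andP[t1 t2].
have bnd (u : R) : u <= M -> (Num.truncn ((u + M) / k) < (Num.truncn ((M + M) / k)).+1)%N.
  by move=> uM; rewrite ltnS le_truncn // ler_pM2r ?invr_gt0 // lerD2r.
move=> /(congr1 val); rewrite /= !inordK ?bnd // => E.
have trP (u : R) : - M <= u -> 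
    (Num.truncn ((u + M) / k))%:R * k <= u + M < (Num.truncn ((u + M) / k)).+1%:R * k.
  move=> uM; rewrite -ler_pdivlMr // -ltr_pdivrMr //; apply: truncn_itv.
  by rewrite divr_ge0 ?(ltW k0) //; lra.
have /andP[] := trP s s1; have /andP[] := trP t t1.
rewrite E; move: (Num.truncn _) => n; rewrite -natr1 mulrDl mul1r => a1 a2 a3 a4.
by apply/andP; split; lra.
Qed.

(** * Semialgebraic sets and projections *)

Fixpoint psubst (R I J : Type) (w : I -> pexpr R J) (p : pexpr R I) : pexpr R J :=
  match p with
  | PConst c => PConst J c
  | PVar i => w i
  | PAdd p q => PAdd (psubst w p) (psubst w q)
  | PMul p q => PMul (psubst w p) (psubst w q)
  end.

Lemma peval_psubst (R : realType) (I J : Type) (w : I -> pexpr R J)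
    (y : J -> R) (p : pexpr R I) :
  peval y (psubst w p) = peval (fun i => peval y (w i)) p.
Proof. by elim: p => //= p -> q ->. Qed.

Lemma semialgebraic_ext (R : realType) (I : Type) (A B : set (I -> R)) :
  (forall x, A x <-> B x) -> semialgebraic A -> semialgebraic B.
Proof. by move=> AB; rewrite (_ : A = B) //; apply/seteqP; split => x /AB. Qed.

Lemma semialgebraic_psubst (R : realType) (I J : Type) (w : I -> pexpr R J)
    (A : set (I -> R)) :
  semialgebraic A -> semialgebraic [set y | A (fun i => peval y (w i))].
Proof.
elim=> {A} [p|p|A B _ sA _ sB|A _ sA].
- apply: semialgebraic_ext (SA_pos (psubst w p)) => y /=.
  by rewrite peval_psubst.
- apply: semialgebraic_ext (SA_zero (psubst w p)) => y /=.
  by rewrite peval_psubst.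
- exact: SA_union.
- exact: SA_compl.
Qed.

Lemma semialgebraic_reindex (R : realType) (I J : Type) (h : I -> J)
    (A : set (I -> R)) :
  semialgebraic A -> semialgebraic [set y : J -> R | A (y \o h)].
Proof. exact: (semialgebraic_psubst (fun i => PVar R (h i))). Qed.

Lemma semialgebraicI (R : realType) (I : Type) (A B : set (I -> R)) :
  semialgebraic A -> semialgebraic B -> semialgebraic (A `&` B).
Proof.
move=> sA sB; rewrite -[A `&` B]setCK setCI.
by apply/SA_compl/SA_union; apply: SA_compl.
Qed.

Lemma semialgebraicT (R : realType) (I : Type) :
  semialgebraic [set: I -> R].
Proof.
by apply: semialgebraic_ext (SA_zero (PConst I (0 : R))) => x; split.
Qed.

Lemma semialgebraic_imply (R : realType) (I : Type) (A B : set (I -> R)) :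
  semialgebraic A -> semialgebraic B -> semialgebraic [set x | A x -> B x].
Proof.
move=> sA sB; apply: semialgebraic_ext (SA_union (SA_compl sA) sB) => x.
rewrite /setU /setC /=; split=> [[nA|Bx] Ax //|AB].
by case: (pselect (A x)) => Ax; [right; apply: AB|left].
Qed.

Lemma semialgebraic_iff (R : realType) (I : Type) (A B : set (I -> R)) :
  semialgebraic A -> semialgebraic B -> semialgebraic [set x | A x <-> B x].
Proof.
move=> sA sB.
exact: semialgebraicI (semialgebraic_imply sA sB) (semialgebraic_imply sB sA).
Qed.

Lemma semialgebraic_all (R : realType) (I : Type) (K : eqType) (s : seq K)
    (A : K -> set (I -> R)) :
  (forall k, semialgebraic (A k)) ->
  semialgebraic [set x | forall k, k \in s -> A k x].
Proof.
move=> sA; elim: s => [|k s IH].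
  by apply: semialgebraic_ext (semialgebraicT R I) => x; split.
apply: semialgebraic_ext (semialgebraicI (sA k) IH) => x; split.
  by move=> [Ax sAx] k'; rewrite inE => /orP[/eqP ->//|/sAx].
move=> H; split; first by apply: H; rewrite mem_head.
by move=> k' ks; apply: H; rewrite inE ks orbT.
Qed.

Lemma semialgebraic_le (R : realType) (I : Type) (p q : pexpr R I) :
  semialgebraic [set x | peval x p <= peval x q].
Proof.
pose r := PAdd p (PMul (PConst I (-1)) q).
apply: semialgebraic_ext (SA_compl (SA_pos r)) => x /=.
by rewrite mulN1r subr_gt0 leNgt; split => /negP.
Qed.

(** Polynomial expressions are translated to first-order terms, and back, in order to apply
    quantifier elimination for real closed fields; [v] numbers the variables. *)
Fixpoint term_of_pexpr (R : realType) (I : Type) (v : I -> nat)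
    (p : pexpr R I) : GRing.term R :=
  match p with
  | PConst c => GRing.Const c
  | PVar i => GRing.Var R (v i)
  | PAdd p q => GRing.Add (term_of_pexpr v p) (term_of_pexpr v q)
  | PMul p q => GRing.Mul (term_of_pexpr v p) (term_of_pexpr v q)
  end.

Lemma eval_term_of_pexpr (R : realType) (I : Type) (v : I -> nat) (e : seq R)
    (p : pexpr R I) :
  GRing.eval e (term_of_pexpr v p) = peval (fun i => e`_(v i)) p.
Proof. by elim: p => //= p -> q ->. Qed.

Lemma rterm_term_of_pexpr (R : realType) (I : Type) (v : I -> nat)
    (p : pexpr R I) : GRing.rterm (term_of_pexpr v p).
Proof. by elim: p => //= p -> q ->. Qed.

(* [GRing.Inv] gets a junk value: it does not occur in ring terms *)
Fixpoint pexpr_of_term (R : realType) (J : Type) (w : nat -> pexpr R J)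
    (t : GRing.term R) : pexpr R J :=
  match t with
  | GRing.Var n => w n
  | GRing.Const c => PConst J c
  | GRing.NatConst n => PConst J n%:R
  | GRing.Add t u => PAdd (pexpr_of_term w t) (pexpr_of_term w u)
  | GRing.Opp t => PMul (PConst J (-1)) (pexpr_of_term w t)
  | GRing.NatMul t n => PMul (PConst J n%:R) (pexpr_of_term w t)
  | GRing.Mul t u => PMul (pexpr_of_term w t) (pexpr_of_term w u)
  | GRing.Inv t => PConst J 0
  | GRing.Exp t n => iter n (PMul (pexpr_of_term w t)) (PConst J 1)
  end.

Lemma peval_pexpr_of_term (R : realType) (J : Type) (w : nat -> pexpr R J)
    (y : J -> R) (e : seq R) (t : GRing.term R) :
  (forall n, e`_n = peval y (w n)) -> GRing.rterm t ->
  peval y (pexpr_of_term w t) = GRing.eval e t.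
Proof.
move=> ew; elim: t => //=.
- by move=> t IHt u IHu /andP[/IHt -> /IHu ->].
- by move=> t IH /IH ->; rewrite mulN1r.
- by move=> t IH n /IH ->; rewrite mulr_natl.
- by move=> t IHt u IHu /andP[/IHt -> /IHu ->].
- move=> t IH n /IH {}IH; elim: n => //= n ->.
  by rewrite IH exprS.
Qed.

Lemma formula_of_semialgebraic (R : realType) (I : Type) (v : I -> nat)
    (A : set (I -> R)) :
  semialgebraic A ->
  exists2 f : ordered_qelim.ord.formula R, ordered_qelim.ord.rformula f &
    forall e, ordered_qelim.ord.holds e f <-> A (fun i => e`_(v i)).
Proof.
elim=> {A} [p|p|A B _ [f rf fA] _ [g rg gB]|A _ [f rf fA]].
- exists (ordered_qelim.ord.Lt (GRing.Const 0) (term_of_pexpr v p)) => /=.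
    exact: rterm_term_of_pexpr.
  by move=> e; rewrite eval_term_of_pexpr.
- exists (ordered_qelim.ord.Equal (term_of_pexpr v p) (GRing.Const 0)) => /=.
    by rewrite rterm_term_of_pexpr.
  by move=> e; rewrite eval_term_of_pexpr.
- exists (ordered_qelim.ord.Or f g) => /=; first by rewrite rf.
  by move=> e; rewrite fA gB.
- exists (ordered_qelim.ord.Not f) => //= e; by rewrite fA.
Qed.

Lemma semialgebraic_of_formula (R : realType) (J : Type) (w : nat -> pexpr R J)
    (env : (J -> R) -> seq R) (f : ordered_qelim.ord.formula R) :
  (forall y n, (env y)`_n = peval y (w n)) ->
  ordered_qelim.ord.qf_form f -> ordered_qelim.ord.rformula f ->
  semialgebraic [set y | ordered_qelim.ord.holds (env y) f].
Proof.
move=> envE; elim: f => //=.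
- case=> _ _; first by apply: semialgebraic_ext (semialgebraicT R J) => y; split.
  by apply: semialgebraic_ext (SA_compl (semialgebraicT R J)) => y; split=> // /(_ I).
- move=> t u _ /andP[rt ru].
  pose r := PAdd (pexpr_of_term w t) (PMul (PConst J (-1)) (pexpr_of_term w u)).
  apply: semialgebraic_ext (SA_zero r) => y /=.
  rewrite !(peval_pexpr_of_term (envE y)) // mulN1r.
  by split=> [/eqP|->]; rewrite ?subrr // subr_eq0 => /eqP.
- move=> t u _ /andP[rt ru].
  pose r := PAdd (pexpr_of_term w u) (PMul (PConst J (-1)) (pexpr_of_term w t)).
  apply: semialgebraic_ext (SA_pos r) => y /=.
  by rewrite !(peval_pexpr_of_term (envE y)) // mulN1r subr_gt0.
- move=> t u _ /andP[rt ru].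
  apply: semialgebraic_ext (semialgebraic_le (pexpr_of_term w t)
    (pexpr_of_term w u)) => y /=.
  by rewrite !(peval_pexpr_of_term (envE y)).
- move=> f IHf g IHg /andP[qf qg] /andP[rf rg].
  exact: semialgebraicI (IHf qf rf) (IHg qg rg).
- move=> f IHf g IHg /andP[qf qg] /andP[rf rg].
  exact: SA_union (IHf qf rf) (IHg qg rg).
- move=> f IHf g IHg /andP[qf qg] /andP[rf rg].
  exact: semialgebraic_imply (IHf qf rf) (IHg qg rg).
- by move=> f IHf qf rf; apply: SA_compl (IHf qf rf).
Qed.

(** Tarski-Seidenberg for one variable: write the set as a formula, quantify, eliminate the
    quantifier, and read the quantifier-free result as a semialgebraic set. *)
Lemma semialgebraic_ex1 (R : realType) (K : finType) (k : K)
    (A : set (K -> R)) :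
  semialgebraic A ->
  semialgebraic [set x | exists t, A (fun k' => if k' == k then t else x k')].
Proof.
move=> sA.
pose v (k : K) : nat := enum_rank k.
have [f rf fA] := formula_of_semialgebraic v sA.
pose g := ordered_qelim.ord.Exists (v k) f.
have rg : ordered_qelim.ord.rformula g by [].
pose qe := ordered_qelim.ord.quantifier_elim (fun i bc => qe_rcf.qfr_to_formula (qe_rcf.wproj i bc)) g.
have /andP[qq rq] : ordered_qelim.ord.qf_form qe && ordered_qelim.ord.rformula qe.
  exact: (ordered_qelim.ord.quantifier_elim_wf (@qe_rcf.wf_QE_wproj R)).
pose env (x : K -> R) : seq R := [seq x k | k <- enum K].
(* Variable numbers beyond the cardinal of [K] read as 0, in agreement with the default of [nth]. *)
pose w n := if insub n is Some i then PVar R (enum_val (i : 'I_#|K|))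
  else PConst K 0.
have envE x n : (env x)`_n = peval x (w n).
  rewrite /w; case: insubP => [i _ <- /=|].
    rewrite (nth_map (enum_val i)) -?cardE ?ltn_ord //.
    by congr x; apply/esym/enum_val_nth.
  by rewrite -leqNgt => Kn; rewrite nth_default // size_map -cardE.
apply: semialgebraic_ext (semialgebraic_of_formula envE qq rq) => x /=.
have qeP := ordered_qelim.ord.quantifier_elim_rformP (@qe_rcf.wf_QE_wproj R)
  (@qe_rcf.valid_QE_wproj R) (env x) rg.
apply: (iff_trans (B := ordered_qelim.ord.holds (env x) g)).
  by split=> [/(ordered_qelim.ord.qf_evalP _ qq)/qeP //|/qeP/ordered_qelim.ord.qf_evalP]; apply.
have E t : (fun i => (set_nth 0 (env x) (v k) t)`_(v i)) =
    (fun k' => if k' == k then t else x k').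
  apply: funext => i; rewrite nth_set_nth /= /v.
  rewrite -[RHS]/(if i == k then t else x i) (inj_eq val_inj) (inj_eq enum_rank_inj).
  by case: eqP => // _; rewrite envE /w valK /= enum_rankK.
by split=> -[t At]; exists t; [rewrite -E; apply/fA | apply/fA; rewrite E].
Qed.

Lemma semialgebraic_ex_seq (R : realType) (K : finType) (s : seq K)
    (A : set (K -> R)) :
  semialgebraic A ->
  semialgebraic [set x | exists2 x' : K -> R,
    (forall k, k \notin s -> x' k = x k) & A x'].
Proof.
elim: s A => [|k s IH] A sA.
  apply: semialgebraic_ext sA => x; split=> [Ax|[x' /= xx' Ax']]; first by exists x.
  by rewrite (_ : x = x') //; apply: funext => k; rewrite xx'.
apply: semialgebraic_ext (semialgebraic_ex1 k (IH _ sA)) => x /=.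
split=> [[t [x' xx' Ax']]|[x' xx' Ax']].
  exists x' => // i; rewrite inE negb_or => /andP[ik /xx'->].
  by rewrite (negbTE ik).
exists (x' k), x' => // i si; case: eqP => [->//|/eqP ik].
by apply: xx'; rewrite inE negb_or ik.
Qed.

Lemma semialgebraic_ex (R : realType) (I J : finType)
    (P : (I -> R) -> (J -> R) -> Prop) :
  semialgebraic [set v : I + J -> R | P (v \o inl) (v \o inr)] ->
  semialgebraic [set x | exists y, P x y].
Proof.
move=> sP.
have := semialgebraic_ex_seq [seq inr j | j <- enum J] sP.
(* After projection the right-hand coordinates no longer matter, so they are set to 0 to get a set
   over [I] alone. *)
pose w (k : I + J) := match k with inl i => PVar R i | inr _ => PConst I 0 end.
move=> /(semialgebraic_psubst w); apply: semialgebraic_ext => x /=.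
split=> [[v vx Pv]|[y Pxy]].
  exists (v \o inr); rewrite (_ : x = v \o inl) //; apply: funext => i /=.
  by rewrite vx //; apply/negP => /mapP[].
exists (fun k => match k with inl i => x i | inr j => y j end) => //.
by case=> // j /negP[]; apply/mapP; exists j; rewrite ?mem_enum.
Qed.

Lemma semialgebraic_forall (R : realType) (I J : finType)
    (P : (I -> R) -> (J -> R) -> Prop) :
  semialgebraic [set v : I + J -> R | P (v \o inl) (v \o inr)] ->
  semialgebraic [set x | forall y, P x y].
Proof.
move=> sP.
have := SA_compl (semialgebraic_ex (P := fun x y => ~ P x y) (SA_compl sP)).
apply: semialgebraic_ext => x /=; split=> [H y|H [y]//].
by apply: contrapT => nP; apply: H; exists y.
Qed.

(** * Noetherian rings and zero loci *)

(** Linear combinations are built one term at a time, so that facts about the generated ideal follow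
    by induction on membership. *)
Inductive ideal_gen (A : comNzRingType) (S : set A) : A -> Prop :=
| ideal_gen0 : ideal_gen S 0
| ideal_genMD (c x y : A) : S x -> ideal_gen S y -> ideal_gen S (c * x + y).

Lemma ideal_gen_mem (A : comNzRingType) (S : set A) x : S x -> ideal_gen S x.
Proof.
by move=> Sx; rewrite -[x]addr0 -[x]mul1r; apply: ideal_genMD => //; apply: ideal_gen0.
Qed.

Lemma ideal_genD (A : comNzRingType) (S : set A) x y :
  ideal_gen S x -> ideal_gen S y -> ideal_gen S (x + y).
Proof.
move=> Sx Sy; elim: Sx => [|c u v Su _ IH]; first by rewrite add0r.
by rewrite -addrA; apply: ideal_genMD.
Qed.

Lemma ideal_genM (A : comNzRingType) (S : set A) c x :
  ideal_gen S x -> ideal_gen S (c * x).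
Proof.
elim=> [|e u v Su _ IH]; first by rewrite mulr0; apply: ideal_gen0.
by rewrite mulrDr mulrA; apply: ideal_genMD.
Qed.

Lemma ideal_genB (A : comNzRingType) (S : set A) x y :
  ideal_gen S x -> ideal_gen S y -> ideal_gen S (x - y).
Proof. by move=> Sx Sy; rewrite -mulN1r; apply/ideal_genD/ideal_genM. Qed.

Lemma ideal_gen_sub (A : comNzRingType) (S T : set A) :
  S `<=` ideal_gen T -> ideal_gen S `<=` ideal_gen T.
Proof.
move=> ST x; elim=> [|c u v /ST Tu _ Tv]; first exact: ideal_gen0.
by apply/ideal_genD => //; apply/ideal_genM.
Qed.

(** The ascending chain condition in sequential form: no sequence can keep leaving the ideal of its
    predecessors. It directly contradicts sequences built by choice. *)
Definition noetherian (A : comNzRingType) : Prop :=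
  forall a : nat -> A, exists N, ideal_gen (a @` `I_N) (a N).

Lemma noetherian_field (K : fieldType) : noetherian K.
Proof.
move=> a; have [a0|a0] := eqVneq (a 0%N) 0.
  by exists 0%N; rewrite a0; apply: ideal_gen0.
exists 1%N; rewrite -[a 1%N](divfK a0).
by apply/ideal_genM/ideal_gen_mem; exists 0%N.
Qed.

(** Recursive choice in which each new element depends on the set of all previous ones. *)
Definition adjoin_iter (T : Type) (next : set T -> T) (n : nat) : set T :=
  iter n (fun S => S `|` [set next S]) set0.

Lemma adjoin_iterE (T : Type) (next : set T -> T) (n : nat) :
  adjoin_iter next n = (fun i => next (adjoin_iter next i)) @` `I_n.
Proof.
elim: n => [|n IH]; first by rewrite II0 image_set0.
by rewrite IIS image_setU image_set1 -IH.
Qed.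

Lemma ideal_gen_finite (A : comNzRingType) (a : nat -> A) x :
  ideal_gen (range a) x -> exists M, ideal_gen (a @` `I_M) x.
Proof.
elim=> [|c _ v [i _ <-] _ [M Mv]]; first by exists 0%N; apply: ideal_gen0.
exists (maxn i.+1 M); apply: ideal_genMD.
  by exists i => //=; rewrite leq_max leqnn.
apply: ideal_gen_sub Mv => _ [j /= jM <-]; apply: ideal_gen_mem.
by exists j => //=; rewrite leq_max jM orbT.
Qed.

(* Hilbert's basis theorem: if the ideal of a sequence [a] were not finitely
   generated, successive elements of minimal degree outside the ideal of their
   predecessors would have leading coefficients contradicting noetherianity of
   the base ring. *)
Lemma noetherian_poly (A : comNzRingType) :
  noetherian A -> noetherian {poly A}.
Proof.
move=> nA a; apply: contrapT => /forallNP bad.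
pose I := ideal_gen (range a).
pose minimal S x := [/\ I x, ~ ideal_gen S x &
  forall y, I y -> ~ ideal_gen S y -> (size x <= size y)%N].
(* A minimal element exists as soon as [S] lies in the ideal of finitely many terms of [a], since by
   [bad] that ideal misses some [a M]. For other [S] the value 0 is a placeholder. *)
have nextP S : exists x, (exists M, S `<=` ideal_gen (a @` `I_M)) -> minimal S x.
  case: (pselect (exists M, S `<=` ideal_gen (a @` `I_M))) => [[M SM]|nS].
    pose P k := `[< exists x, [/\ I x, ~ ideal_gen S x & size x = k] >].
    have exP : exists k, P k.
      exists (size (a M)); apply/asboolP; exists (a M); split=> //.
        by apply: ideal_gen_mem; exists M.
      by move=> SaM; apply: (bad M); apply: ideal_gen_sub SaM.
    have [k /asboolP[x [Ix nSx <-]] kmin] := ex_minnP exP.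
    exists x => _; split=> // y Iy nSy; apply: kmin.
    by apply/asboolP; exists y.
  by exists 0 => /nS.
have {nextP} [next nextP] := choice nextP.
pose S := adjoin_iter next; pose f n := next (S n).
have SE n : S n = f @` `I_n by exact: adjoin_iterE.
have finS n : exists M, S n `<=` ideal_gen (a @` `I_M).
  elim: n => [|n IH]; first by exists 0%N.
  have [In _ _] := nextP (S n) IH.
  have [M1 SM1] := IH; have [M2 SM2] := ideal_gen_finite In.
  exists (maxn M1 M2) => x [/SM1|->].
    apply: ideal_gen_sub => _ [j /= jM <-]; apply: ideal_gen_mem.
    by exists j => //=; rewrite leq_max jM.
  apply: ideal_gen_sub SM2 => _ [j /= jM <-]; apply: ideal_gen_mem.
  by exists j => //=; rewrite leq_max jM orbT.
have fP n : minimal (S n) (f n) := nextP _ (finS n).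
have [N TN] := nA (fun n => lead_coef (f n)).
pose T := (fun n => lead_coef (f n)) @` `I_N.
have [IfN nfN minN] := fP N.
have fN0 : (0 < size (f N))%N.
  by rewrite size_poly_gt0; apply/eqP => f0; apply: nfN; rewrite f0; apply: ideal_gen0.
(* Earlier [f i] have size at most that of [f N], so multiplying by a power of ['X] aligns their
   leading terms with that of [f N]. A relation between leading coefficients thus lifts to an
   element of the ideal. *)
have lift l : ideal_gen T l -> exists h, [/\ ideal_gen (S N) h,
    (size h <= size (f N))%N & h`_(size (f N)).-1 = l].
  elim=> [|c _ y [i /= iN <-] _ [h [Sh sh hl]]].
    by exists 0; rewrite size_poly0 coef0; split=> //; apply: ideal_gen0.
  have [Ifi nfi mini] := fP i.
  have fi0 : (0 < size (f i))%N.
    by rewrite size_poly_gt0; apply/eqP => f0; apply: nfi; rewrite f0; apply: ideal_gen0.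
  have lei : (size (f i) <= size (f N))%N.
    apply: mini => // Si; apply: nfN; apply: ideal_gen_sub Si.
    rewrite [S i]SE => _ [j /= ji <-]; apply: ideal_gen_mem.
    by rewrite SE; exists j => //=; apply: ltn_trans iN.
  pose m := (c%:P * 'X^(size (f N) - size (f i))) * f i.
  exists (m + h); split.
  - apply/ideal_genD => //; apply/ideal_genM/ideal_gen_mem.
    by rewrite SE; exists i.
  - rewrite (leq_trans (size_polyD _ _)) // geq_max sh andbT.
    rewrite /m -mulrA mul_polyC (leq_trans (size_scale_leq _ _)) //.
    rewrite (leq_trans (size_polyMleq _ _)) // size_polyXn addSn /=.
    by rewrite subnK.
  - rewrite coefD hl /m -mulrA mul_polyC coefZ coefXnM.
    have arith (k m' : nat) : (0 < k <= m')%N ->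
      (m'.-1 < m' - k)%N = false /\ (m'.-1 - (m' - k) = k.-1)%N by lia.
    by have [-> ->] := arith _ _ (introT andP (conj fi0 lei)).
have [h [Sh sh hl]] := lift _ TN.
(* The leading terms cancel, so [f N - h] is smaller than [f N] yet still outside the ideal of
   [S N], against minimality. *)
have /minN : I (f N - h).
  apply/ideal_genB => //; apply: ideal_gen_sub Sh.
  by rewrite SE => _ [j _ <-]; have [] := fP j.
have ngen : ~ ideal_gen (S N) (f N - h).
  by move=> gN; apply: nfN; rewrite -(subrK h (f N)); apply: ideal_genD.
move=> /(_ ngen); rewrite leqNgt => /negP; apply.
rewrite -[X in (_ < X)%N](prednK fN0) ltnS; apply/leq_sizeP => j.
rewrite leq_eqVlt coefB => /predU1P[<-|ltj]; first by rewrite hl subrr.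
rewrite !nth_default ?subrr //; last by rewrite -(prednK fN0).
by rewrite (leq_trans sh) // -(prednK fN0).
Qed.

(** Iterating the basis theorem gives the polynomial ring in [n] variables, presented only through
    its evaluation morphisms, constants and variables. *)
Lemma noetherian_poly_functions (R : realType) (n : nat) :
  exists (A : comNzRingType) (ev : (nat -> R) -> {rmorphism A -> R})
         (cst : R -> A) (X : nat -> A),
    [/\ noetherian A, (forall x c, ev x (cst c) = c) &
        forall x i, (i < n)%N -> ev x (X i) = x i].
Proof.
elim: n => [|n [A [ev [cst [X [nA evC evX]]]]]].
  exists R, (fun _ => idfun), idfun, (fun _ => 0); split=> //.
  exact: noetherian_field.
(* The newest variable is the outer ['X]: evaluate the coefficients first, then substitute [x n]. *)
exists {poly A}, (fun x => horner_eval (x n) \o map_poly (ev x)),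
  (fun c => (cst c)%:P), (fun i => if i == n then 'X else (X i)%:P).
split=> [|x c|x i ltin]; first exact: noetherian_poly.
  by rewrite /= /horner_eval map_polyC /= hornerC evC.
rewrite /= /horner_eval; case: eqP => [->|/eqP neq].
  by rewrite map_polyX hornerX.
rewrite map_polyC /= hornerC evX //.
by rewrite ltn_neqAle neq -ltnS.
Qed.

(** If no finite part of [F] had the same zeros, one could forever choose members of [F] outside the
    ideal of those already chosen, contradicting noetherianity: polynomials in that ideal vanish
    wherever its generators do. *)
Lemma finite_zero_locus (R : realType) (I : finType) (F : set (pexpr R I)) :
  exists N (p : nat -> pexpr R I), (forall i, (i < N)%N -> F (p i)) /\
    forall x, (forall i, (i < N)%N -> peval x (p i) = 0) ->
    forall q, F q -> peval x q = 0.
Proof.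
have [A [ev [cst [X [nA evC evX]]]]] := noetherian_poly_functions R #|I|.
pose tr := fix loop (p : pexpr R I) : A := match p with
  | PConst c => cst c | PVar i => X (enum_rank i)
  | PAdd p q => loop p + loop q | PMul p q => loop p * loop q end.
pose cx (x : I -> R) (k : nat) : R :=
  if insub k is Some i then x (enum_val (i : 'I_#|I|)) else 0.
have trE x p : ev (cx x) (tr p) = peval x p.
  elim: p => /= [c|i|p IHp q IHq|p IHp q IHq].
  - exact: evC.
  - by rewrite evX // /cx valK enum_rankK.
  - by rewrite rmorphD IHp IHq.
  - by rewrite rmorphM IHp IHq.
have evS x S a : (forall b, S b -> ev (cx x) b = 0) -> ideal_gen S a -> ev (cx x) a = 0.
  move=> S0; elim=> [|c u v /S0 u0 _ v0]; first exact: rmorph0.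
  by rewrite rmorphD rmorphM u0 v0 mulr0 addr0.
apply: contrapT => nfin.
have nextP S : exists q, (exists N p, (forall i, (i < N)%N -> F (p i)) /\ S = p @` `I_N) ->
    F q /\ ~ ideal_gen (tr @` S) (tr q).
  case: (pselect (exists N p, (forall i, (i < N)%N -> F (p i)) /\ S = p @` `I_N)).
    move=> [N [p [Fp SE]]]; apply: contrapT => /forallNP nq; apply: nfin.
    exists N, p; split=> // x px0 q Fq; rewrite -trE.
    apply: (evS x (tr @` S)).
      by rewrite SE => _ [_ [i /= /px0 pi <-] <-]; rewrite trE.
    by apply: contrapT => nqS; apply: (nq q) => _.
  by move=> nS; exists (PConst I 0) => /nS.
have {nextP} [next nextP] := choice nextP.
pose S := adjoin_iter next; pose f n := next (S n).
have SE n : S n = f @` `I_n by exact: adjoin_iterE.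
have Ff n : forall i, (i < n)%N -> F (f i).
  elim: n => // n IH i; rewrite ltnS leq_eqVlt => /predU1P[->|/IH//].
  by have [] := nextP (S n) (ex_intro _ n (ex_intro _ f (conj IH (SE n)))).
have [N] := nA (fun n => tr (f n)).
have [_] := nextP (S N) (ex_intro _ N (ex_intro _ f (conj (Ff N) (SE N)))).
by move=> nG gN; apply: nG; rewrite [X in tr @` X]SE image_comp.
Qed.

(** * Invariant forms of least norm *)

Lemma continuous_sumr (R : realType) (T : topologicalType) (I : Type) (s : seq I)
    (f : I -> T -> R) :
  (forall i, continuous (f i)) -> continuous (fun x => \sum_(i <- s) f i x).
Proof.
move=> cf; elim: s => [|i s IH] x.
  rewrite (_ : (fun x => _) = fun=> 0); first exact: cst_continuous.
  by apply: funext => y; rewrite big_nil.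
rewrite (_ : (fun x => _) = f i \+ fun x => \sum_(i <- s) f i x).
  by apply: continuousD; [exact: cf|exact: IH].
by apply: funext => y; rewrite big_cons.
Qed.

Definition normsq (R : realType) (N : nat) (T : 'rV[R]_N) : R := \sum_k T 0 k ^+ 2.

Lemma normsq_continuous (R : realType) (N : nat) : continuous (@normsq R N).
Proof.
apply: continuous_sumr => k v.
rewrite (_ : (fun x => _) = (fun x : 'rV[R]_N => x 0 k) \* (fun x : 'rV[R]_N => x 0 k)).
  by apply: continuousM; exact: coord_continuous.
by apply: funext => y; rewrite expr2.
Qed.

Lemma min_normsq_exists (R : realType) (N : nat) (Q : set 'rV[R]_N) :
  closed Q -> Q !=set0 ->
  exists2 T, Q T & forall S, Q S -> normsq T <= normsq S.
Proof.
move=> cQ [T0 QT0].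
pose A := Q `&` [set T | normsq T <= normsq T0].
have cA : closed A.
  apply: closedI => //.
  by apply: closed_comp (@closed_le _ (normsq T0)) => T _; apply: normsq_continuous.
have bA : bounded_set A.
  exists (1 + normsq T0); split; first by rewrite num_real.
  move=> M ltM T [_ /= TT0].
  have T00 : 0 <= normsq T0 by rewrite sumr_ge0 // => k _; rewrite sqr_ge0.
  have M0 : 0 <= M by lra.
  rewrite /Num.norm /= mx_normrE; apply/bigmax_leP; split=> // -[i k] _ /=.
  rewrite ord1; have h : T 0 k ^+ 2 <= normsq T.
    by rewrite /normsq (bigD1 k) //= lerDl sumr_ge0 // => j _; rewrite sqr_ge0.
  have : `|T 0 k| ^+ 2 <= normsq T0 by rewrite real_normK ?num_real // (le_trans h).
  move: (normr_ge0 (T 0 k)) => n0 n1; move: ltM; nra.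
have A0 : A !=set0 by exists T0; split=> //=.
have cont : {within A, continuous (@normsq R N)}.
  by apply: continuous_subspaceT; exact: normsq_continuous.
have [T + Tmin] := EVT_min_rV A0 (bounded_closed_compact bA cA) cont.
rewrite inE => -[QT /= TT0]; exists T => // S QS.
have [ST|/ltW TS] := leP (normsq S) (normsq T0); last exact: le_trans TS.
by apply: Tmin; rewrite inE; split.
Qed.

(** By the parallelogram law, the midpoint of two distinct minimizers would have smaller norm. *)
Lemma min_normsq_unique (R : realType) (N : nat) (Q : set 'rV[R]_N) (S T : 'rV[R]_N) :
  (forall U V, Q U -> Q V -> Q (2^-1 *: (U + V))) ->
  Q S -> Q T -> (forall U, Q U -> normsq T <= normsq U) -> normsq S = normsq T ->
  S = T.
Proof.
move=> midQ QS QT Tmin ST.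
have par : normsq (2^-1 *: (S + T)) + 4^-1 * normsq (S - T) =
    2^-1 * (normsq S + normsq T).
  rewrite /normsq mulr_sumr -!big_split /= mulr_sumr; apply: eq_bigr => k _.
  by rewrite !mxE; field.
have := Tmin _ (midQ _ _ QS QT) => le0.
have d0 : normsq (S - T) <= 0 by move: par le0; rewrite ST; lra.
apply/matrixP => i k; rewrite ord1; apply/eqP; rewrite -subr_eq0.
have : (S - T) 0 k ^+ 2 <= 0.
  apply: le_trans d0; rewrite /normsq (bigD1 k) //= lerDl.
  by rewrite sumr_ge0 // => j _; rewrite sqr_ge0.
by rewrite real_exprn_even_le0 ?num_real //= !mxE.
Qed.

Section TensorPower.
Variables (R : realType) (D m : nat).

Notation tdim := #|{ffun 'I_m -> 'I_D}|.

Definition multi_index (k : 'I_tdim) : {ffun 'I_m -> 'I_D} := enum_val k.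

Lemma prod_sum_tensor (F : 'I_m -> 'I_D -> R) :
  \prod_i \sum_j F i j = \sum_(k < tdim) \prod_i F i (multi_index k i).
Proof. by rewrite bigA_distr_bigA big_enum_val. Qed.

(** The [m]-th tensor power of [u]. A form of degree [m] in [u] is then a linear form in [vpow u],
    given by a row of coefficients that need not be symmetric. *)
Definition vpow (u : 'cV[R]_D) : 'rV[R]_tdim := \row_k \prod_i u (multi_index k i) 0.

(** The [m]-th Kronecker power of [g]: acting on coefficient rows it amounts to substituting
    [g *m u] for [u], and it preserves their norm when [g] is orthogonal. *)
Definition mxpow (g : 'M[R]_D) : 'M[R]_tdim :=
  \matrix_(k, l) \prod_i g (multi_index k i) (multi_index l i).

Definition tform (T : 'rV[R]_tdim) (u : 'cV[R]_D) : R := \sum_k T 0 k * vpow u 0 k.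

Lemma tform_vpow a u : tform (vpow a) u = inner a u ^+ m.
Proof.
rewrite /inner -[X in _ ^+ X]card_ord -prodr_const prod_sum_tensor.
by apply: eq_bigr => k _; rewrite !mxE -big_split.
Qed.

Lemma mxpow1 : mxpow 1%:M = 1%:M.
Proof.
apply/matrixP => k l; rewrite !mxE; case: eqP => [->|kl].
  by rewrite big1 // => i _; rewrite mxE eqxx.
have /existsP[i ki] : [exists i, multi_index k i != multi_index l i].
  rewrite -negb_forall; apply/negP => /forallP E; apply: kl; apply: enum_val_inj.
  by apply/ffunP => i; apply/eqP.
by rewrite (bigD1 i) //= mxE (negbTE ki) mul0r.
Qed.

Lemma mxpowM g h : mxpow (g *m h) = mxpow g *m mxpow h.
Proof.
apply/matrixP => k l; rewrite !mxE.
under eq_bigr => i _ do rewrite mxE.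
by rewrite prod_sum_tensor; apply: eq_bigr => j _; rewrite !mxE -big_split.
Qed.

Lemma mxpow_tr g : mxpow g^T = (mxpow g)^T.
Proof. by apply/matrixP => k l; rewrite !mxE; apply: eq_bigr => i _; rewrite mxE. Qed.

Lemma tform_mxpow T g u : tform (T *m mxpow g) u = tform T (g *m u).
Proof.
rewrite /tform.
under eq_bigr => k _ do rewrite mxE mulr_suml.
rewrite exchange_big /=; apply: eq_bigr => l _.
under eq_bigr => k _ do rewrite -mulrA.
rewrite -mulr_sumr; congr (_ * _); rewrite !mxE.
under [RHS]eq_bigr => i _ do rewrite mxE.
by rewrite prod_sum_tensor; apply: eq_bigr => k _; rewrite !mxE -big_split.
Qed.

Lemma normsq_mxpow T g : orthogonal_mx g -> normsq (T *m mxpow g) = normsq T.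
Proof.
have nE S : normsq S = (S *m S^T) 0 0 by rewrite mxE; apply: eq_bigr => k _; rewrite mxE expr2.
move=> og; rewrite !nE trmx_mul mulmxA -(mulmxA T) -mxpow_tr -mxpowM og mxpow1.
by rewrite mulmx1.
Qed.

Lemma tformD S T u : tform (S + T) u = tform S u + tform T u.
Proof. by rewrite -big_split; apply: eq_bigr => k _; rewrite mxE mulrDl. Qed.

Lemma tformZ c T u : tform (c *: T) u = c * tform T u.
Proof. by rewrite mulr_sumr; apply: eq_bigr => k _; rewrite mxE mulrA. Qed.

Lemma tform_sum (I : Type) (s : seq I) (T : I -> 'rV[R]_tdim) u :
  tform (\sum_(i <- s) T i) u = \sum_(i <- s) tform (T i) u.
Proof.
elim: s => [|i s IH]; last by rewrite !big_cons tformD IH.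
by rewrite !big_nil -[X in tform X](scale0r 0) tformZ mul0r.
Qed.

Lemma tform_continuous u : continuous (fun T => tform T u).
Proof.
apply: continuous_sumr => k v.
rewrite (_ : (fun x => _) = (fun x : 'rV[R]_tdim => x 0 k) \* (fun=> vpow u 0 k)) //.
by apply: continuousM; [exact: coord_continuous|exact: cst_continuous].
Qed.

(* The separating forms are a closed convex set stable under [H], so its
   element of least norm is fixed by [H]; this replaces Haar averaging. *)
Lemma invariant_separating_form (H : set 'M[R]_D) (A C : set 'cV[R]_D) (T0 : 'rV[R]_tdim) :
  (forall g, H g -> orthogonal_mx g) ->
  (forall g u, H g -> A u -> A (g *m u)) -> (forall g u, H g -> C u -> C (g *m u)) ->
  (forall u, A u -> 1 <= tform T0 u) -> (forall u, C u -> tform T0 u <= 2^-1) ->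
  exists T, [/\ (forall u, A u -> 1 <= tform T u), (forall u, C u -> tform T u <= 2^-1) &
    forall g u, H g -> tform T (g *m u) = tform T u].
Proof.
move=> oH HA HC T0A T0C.
pose Q := (\bigcap_(u in A) [set T | 1 <= tform T u]) `&`
          (\bigcap_(u in C) [set T | tform T u <= 2^-1]).
have cQ : closed Q.
  apply: closedI; apply: closed_bigI => u _.
    by apply: closed_comp (@closed_ge _ 1) => T _; apply: tform_continuous.
  by apply: closed_comp (@closed_le _ 2^-1) => T _; apply: tform_continuous.
have [T QT Tmin] := min_normsq_exists cQ (ex_intro _ T0 (conj T0A T0C)).
exists T; split=> [u Au|u Cu|g u Hg].
- by have [/(_ u Au)] := QT.
- by have [_ /(_ u Cu)] := QT.
rewrite -tform_mxpow; congr tform; apply: (@min_normsq_unique _ _ Q) => //.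
- move=> U V [UA UC] [VA VC]; split=> v.
    move=> Av; have := UA v Av; have := VA v Av; rewrite /= tformZ tformD; lra.
  move=> Cv; have := UC v Cv; have := VC v Cv; rewrite /= tformZ tformD; lra.
- have [QA QC] := QT; split=> v hv /=; rewrite tform_mxpow.
    exact: QA (HA _ _ Hg hv).
  exact: QC (HC _ _ Hg hv).
- by rewrite normsq_mxpow //; apply: oH.
Qed.

End TensorPower.

(** * Invariant polynomials separate closed orbits *)

Definition polyfun (R : realType) (I : Type) (f : (I -> R) -> R) : Prop :=
  exists p : pexpr R I, forall x, peval x p = f x.

Section PolyFun.
Variables (R : realType) (I : Type).
Implicit Types f g : (I -> R) -> R.

Lemma polyfun_ext f g : (forall x, f x = g x) -> polyfun f -> polyfun g.
Proof. by move=> fg [p pf]; exists p => x; rewrite pf. Qed.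

Lemma polyfun_cst c : polyfun (fun _ : I -> R => c).
Proof. by exists (PConst I c). Qed.

Lemma polyfun_var i : polyfun (fun x : I -> R => x i).
Proof. by exists (PVar R i). Qed.

Lemma polyfunD f g : polyfun f -> polyfun g -> polyfun (fun x => f x + g x).
Proof. by move=> [p pf] [q qg]; exists (PAdd p q) => x /=; rewrite pf qg. Qed.

Lemma polyfunM f g : polyfun f -> polyfun g -> polyfun (fun x => f x * g x).
Proof. by move=> [p pf] [q qg]; exists (PMul p q) => x /=; rewrite pf qg. Qed.

Lemma polyfunB f g : polyfun f -> polyfun g -> polyfun (fun x => f x - g x).
Proof.
move=> pf pg; apply: polyfun_ext (polyfunD pf (polyfunM (polyfun_cst (-1)) pg)) => x.
by rewrite mulN1r.
Qed.

Lemma polyfun_sum (K : Type) (s : seq K) (f : K -> (I -> R) -> R) :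
  (forall k, polyfun (f k)) -> polyfun (fun x => \sum_(k <- s) f k x).
Proof.
move=> pf; elim: s => [|k s IH].
  by apply: polyfun_ext (polyfun_cst 0) => x; rewrite big_nil.
by apply: polyfun_ext (polyfunD (pf k) IH) => x; rewrite big_cons.
Qed.

Lemma polyfun_prod (K : Type) (s : seq K) (f : K -> (I -> R) -> R) :
  (forall k, polyfun (f k)) -> polyfun (fun x => \prod_(k <- s) f k x).
Proof.
move=> pf; elim: s => [|k s IH].
  by apply: polyfun_ext (polyfun_cst 1) => x; rewrite big_nil.
by apply: polyfun_ext (polyfunM (pf k) IH) => x; rewrite big_cons.
Qed.

End PolyFun.

Lemma polyfun_reindex (R : realType) (I J : Type) (h : I -> J) (f : (I -> R) -> R) :
  polyfun f -> polyfun (fun y : J -> R => f (y \o h)).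
Proof.
by move=> [p pf]; exists (psubst (fun i => PVar R (h i)) p) => y; rewrite peval_psubst -pf.
Qed.

Definition vec (R : realType) (d : nat) (f : 'I_d -> R) : 'cV[R]_d := \col_i f i.

Lemma polyfun_inner (R : realType) (d : nat) (I : Type) (a b : 'I_d -> I) :
  polyfun (fun w : I -> R => inner (vec (w \o a)) (vec (w \o b))).
Proof.
apply: polyfun_sum => k; apply: polyfun_ext (polyfunM (polyfun_var R (a k)) (polyfun_var R (b k))) => w.
by rewrite !mxE.
Qed.

(** Pick a point of [A] in each cell that meets [A], and [x0] for the cells that do not. *)
Lemma finite_net (R : realType) (d : nat) (A : set 'cV[R]_d) (x0 : 'cV[R]_d) (M k : R) :
  0 < k -> A x0 -> (forall u i, A u -> `|u i 0| <= M) ->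
  exists (K : finType) (a : K -> 'cV[R]_d), (forall c, A (a c)) /\
    forall u, A u -> exists c, forall i, `|u i 0 - a c i 0| <= k.
Proof.
move=> k0 Ax0 AM.
pose cells (u : 'cV[R]_d) := [ffun i => cell M k (u i 0)].
have aP c : exists a, A a /\ ((exists2 u, A u & cells u = c) -> cells a = c).
  case: (pselect (exists2 u, A u & cells u = c)) => [[u Au uc]|nu].
    by exists u.
  by exists x0; split=> // /nu.
have [a {}aP] := choice aP.
exists {ffun 'I_d -> 'I_(Num.truncn ((M + M) / k)).+1}, a; split=> [c|u Au].
  by have [] := aP c.
exists (cells u) => i; have [Aa ac] := aP (cells u).
have /ffunP/(_ i) : cells (a (cells u)) = cells u by apply: ac; exists u.
by rewrite !ffunE => /esym; apply: cell_close => //; apply: AM.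
Qed.

Lemma expr_small (R : realType) (q c : R) : 0 <= q < 1 -> 0 < c -> exists m, q ^+ m <= c.
Proof.
move=> /andP[q0 q1] c0.
have /cvgrPdist_le/(_ _ c0)[m _ /(_ m)] := @cvg_expr R q ltac:(by rewrite ger0_norm).
by rewrite /= sub0r normrN ger0_norm ?exprn_ge0 // => h; exists m; apply: h; apply: leqnn.
Qed.

Section Separation.
Variables (R : realType) (d : nat) (s : R).

(* The additional coordinate [s], on which the group acts trivially, makes
   inhomogeneous polynomials in [u] homogeneous. *)
Definition extv (u : 'cV[R]_d) : 'cV[R]_(1 + d) := col_mx s%:M u.
Definition extm (g : 'M[R]_d) : 'M[R]_(1 + d) := block_mx 1%:M 0 0 g.

Lemma extm_extv g u : extm g *m extv u = extv (g *m u).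
Proof. by rewrite /extm mul_block_col mul1mx !mul0mx addr0 add0r. Qed.

Lemma orthogonal_extm g : orthogonal_mx g -> orthogonal_mx (extm g).
Proof.
rewrite /orthogonal_mx /extm => og.
rewrite tr_block_mx mulmx_block !(mulmx0, mul0mx, mulmx1, addr0, add0r, trmx0, trmx1) og.
by rewrite -scalar_mx_block.
Qed.

Lemma inner_extv u v : inner (extv u) (extv v) = s ^+ 2 + inner u v.
Proof.
rewrite /inner big_split_ord /= big_ord1 !col_mxEu !mxE mulr1n expr2; congr (_ + _).
by apply: eq_bigr => i _; rewrite !col_mxEd.
Qed.

Lemma polyfun_tform (m : nat) (T : 'rV[R]_#|{ffun 'I_m -> 'I_(1 + d)}|) :
  polyfun (fun f : 'I_d -> R => tform T (extv (vec f))).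
Proof.
apply: polyfun_sum => k; apply: polyfunM; first exact: polyfun_cst.
suff : polyfun (fun f : 'I_d -> R => \prod_i extv (vec f) (multi_index k i) 0).
  by apply: polyfun_ext => f; rewrite mxE.
apply: polyfun_prod => i; case: (splitP (multi_index k i)) => j kj.
  have -> : multi_index k i = lshift d j by apply: val_inj.
  apply: polyfun_ext (polyfun_cst _ s) => f.
  by rewrite col_mxEu mxE ord1 mulr1n.
have -> : multi_index k i = rshift 1 j by apply: val_inj.
by apply: polyfun_ext (polyfun_var _ j) => f; rewrite col_mxEd mxE.
Qed.

End Separation.

(** On a sphere the kernel [inner (extv s u) (extv s v)] decreases with the distance of [u] and [v].
    Summing high powers of it over a finite net of the orbit of [x] gives a form that is large on
    this orbit and small on that of [y]; the form of least norm with these bounds is invariant. *)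
Lemma separating_invariant (R : realType) (d : nat) (G : set 'M[R]_d) (x y : 'cV[R]_d) :
  orth_group G -> closed (gorbit G y) -> inner x x = inner y y ->
  gorbit G x <> gorbit G y ->
  exists f : 'cV[R]_d -> R, [/\ polyfun (fun w => f (vec w)),
    forall g u, G g -> f (g *m u) = f u & f x <> f y].
Proof.
move=> Gg cy; set r := inner x x => xy nxy.
have [oG G1 GM _] := Gg.
have [e e0 sep] := gorbit_separated Gg cy nxy.
pose s : R := Num.sqrt r.
have s2 : s ^+ 2 = r by rewrite sqr_sqrtr // inner_ge0.
have s0 : 0 <= s by exact: sqrtr_ge0.
have nx u : gorbit G x u -> inner u u = r by move=> /(inner_gorbit Gg).
have ny u : gorbit G y u -> inner u u = r by move=> /(inner_gorbit Gg) ->.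
have kernelE (u v : 'cV[R]_d) : inner u u = r -> inner v v = r ->
    inner (extv s u) (extv s v) = r + r - inner (u - v) (u - v) / 2.
  by rewrite inner_extv s2 !(innerBl, innerBr) (innerC v u) => -> ->; field.
have kernel_ge0 (u v : 'cV[R]_d) : inner u u = r -> inner v v = r -> 0 <= inner (extv s u) (extv s v).
  move=> ur vr; rewrite inner_extv s2.
  have : `|inner u v| <= s * s by apply: normr_inner_le; rewrite // s2 ?ur ?vr.
  by rewrite -expr2 s2 ler_norml => /andP[]; lra.
(* Coordinates within [k] give Euclidean distance at most e/2. *)
pose k := e / (d.+1%:R *+ 2).
have k0 : 0 < k by rewrite divr_gt0 // mulrn_wgt0 ?ltr0n.
have bx u i : gorbit G x u -> `|u i 0| <= s.
  by move=> /nx ur; apply: coord_le_inner; rewrite // s2 ur.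
have [K [a [Aa anet]]] := finite_net k0 (gorbit_refl x Gg) bx.
(* [al] bounds the kernel from below at distance at most e/2, and [be] bounds it from above at
   distance at least [e]. *)
pose al := r + r - e ^+ 2 / 8; pose be := r + r - e ^+ 2 / 2.
have e20 : 0 < e ^+ 2 by rewrite exprn_gt0.
have be0 : 0 <= be.
  have xx := gorbit_refl x Gg; have yy := gorbit_refl y Gg.
  have := kernel_ge0 _ _ (nx _ xx) (ny _ yy); rewrite (kernelE _ _ (nx _ xx) (ny _ yy)) /be.
  by have := sep _ _ xx yy; lra.
have al0 : 0 < al by move: be0; rewrite /al /be; lra.
(* The power [m] is so high that all the terms of the net together, each at most [be ^+ m], stay
   below half of [al ^+ m]. *)
have [m qm] : exists m, (be / al) ^+ m <= (#|K|.+1%:R *+ 2)^-1.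
  apply: expr_small; last by rewrite invr_gt0 mulrn_wgt0 ?ltr0n.
  rewrite divr_ge0 ?(ltW al0) //= ltr_pdivrMr // mul1r /be /al; lra.
have alm0 : 0 < al ^+ m by rewrite exprn_gt0.
pose T0 := (al ^- m) *: \sum_c vpow m (extv s (a c)).
have T0E u : tform T0 u = (al ^- m) * \sum_c inner (extv s (a c)) u ^+ m.
  by rewrite tformZ tform_sum; under eq_bigr => c _ do rewrite tform_vpow.
pose H := [set extm g | g in G].
pose A := [set extv s u | u in gorbit G x].
pose C := [set extv s u | u in gorbit G y].
have oH g : H g -> orthogonal_mx g by move=> [h Gh <-]; apply/orthogonal_extm/oG.
have HA g u : H g -> A u -> A (g *m u).
  move=> [h Gh <-] [v xv <-]; rewrite extm_extv; exists (h *m v) => //.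
  exact: gorbit_stable.
have HC g u : H g -> C u -> C (g *m u).
  move=> [h Gh <-] [v xv <-]; rewrite extm_extv; exists (h *m v) => //.
  exact: gorbit_stable.
have T0A u : A u -> 1 <= tform T0 u.
  move=> [v xv <-]; rewrite T0E ler_pdivlMl // mulr1.
  have [c vc] := anet v xv.
  rewrite (bigD1 c) //=; apply: ler_wpDr.
    by rewrite sumr_ge0 // => c' _; rewrite exprn_ge0 // (kernel_ge0 _ _ (nx _ (Aa c')) (nx _ xv)).
  rewrite lerXn2r ?nnegrE ?(ltW al0) ?(kernel_ge0 _ _ (nx _ (Aa c)) (nx _ xv)) //.
  rewrite (kernelE _ _ (nx _ (Aa c)) (nx _ xv)).
  have : inner (a c - v) (a c - v) <= (d%:R * k) ^+ 2.
    apply: inner_le_coords; first exact: ltW.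
    by move=> i; rewrite !mxE distrC.
  have : (d%:R * k) ^+ 2 <= (e / 2) ^+ 2.
    rewrite lerXn2r ?nnegrE ?mulr_ge0 ?(ltW k0) ?divr_ge0 ?(ltW e0) //.
    have kE : k * (d%:R + 1) * 2 = e.
      by rewrite natr1 /k -mulr_natr; field; rewrite ?natr1 ?nat1r pnatr_eq0.
    by rewrite -kE; move: k0; nra.
  by rewrite (_ : (e / 2) ^+ 2 = e ^+ 2 / 4) /al; [lra|field].
have T0C u : C u -> tform T0 u <= 2^-1.
  move=> [v yv <-]; rewrite T0E ler_pdivrMl //.
  apply: (@le_trans _ _ (\sum_(c : K) be ^+ m)).
    apply: ler_sum => c _; rewrite lerXn2r ?nnegrE ?(kernel_ge0 _ _ (nx _ (Aa c)) (ny _ yv)) //.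
    rewrite (kernelE _ _ (nx _ (Aa c)) (ny _ yv)) /be.
    by have := sep _ _ (Aa c) yv; lra.
  rewrite sumr_const; move: qm; rewrite expr_div_n ler_pdivrMr // => qm.
  apply: (@le_trans _ _ (be ^+ m *+ #|K|.+1)).
    by rewrite mulrS lerDr exprn_ge0.
  rewrite -mulr_natr; apply: (@le_trans _ _ ((#|K|.+1%:R *+ 2)^-1 * al ^+ m * #|K|.+1%:R)).
    by rewrite ler_pM2r // ltr0n.
  rewrite -mulr_natr invfM le_eqVlt; apply/orP; left; apply/eqP; field.
  by rewrite ?natr1 ?nat1r pnatr_eq0.
have [T [TA TC Tinv]] := invariant_separating_form oH HA HC T0A T0C.
exists (fun u => tform T (extv s u)); split=> [|g u Ggg|E].
- exact: polyfun_tform.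
- by rewrite -extm_extv Tinv //; exists g.
- have := TA _ (ex_intro2 _ _ x (gorbit_refl x Gg) erefl).
  have := TC _ (ex_intro2 _ _ y (gorbit_refl y Gg) erefl).
  by rewrite -E; lra.
Qed.

(** The relation is the zero locus of all polynomials in two vectors that vanish on it: among them
    are the differences f(x) - f(y) for invariant [f], which already separate orbits. Finitely many
    of them cut out the same locus. *)
Lemma semialgebraic_gorbit (R : realType) (d : nat) (G : set 'M[R]_d) :
  orth_group G -> (forall x, closed (gorbit G x)) ->
  semialgebraic [set w : 'I_d + 'I_d -> R |
    gorbit G (vec (w \o inl)) = gorbit G (vec (w \o inr))].
Proof.
move=> Gg cG.
pose F := [set p : pexpr R ('I_d + 'I_d) | forall w,
  gorbit G (vec (w \o inl)) = gorbit G (vec (w \o inr)) -> peval w p = 0].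
have [N [p [Fp Fq]]] := finite_zero_locus F.
apply: semialgebraic_ext (semialgebraic_all (iota 0 N) (fun i => SA_zero (p i))) => w /=.
split=> [pw|E i]; last by rewrite mem_iota add0n => /Fp; apply.
have {pw} F0 : forall q, F q -> peval w q = 0.
  by apply: Fq => i iN; apply: pw; rewrite mem_iota.
apply: contrapT => nE.
set x := vec (w \o inl) in nE; set y := vec (w \o inr) in nE.
have same_orbit u v (f : 'cV[R]_d -> R) :
    (forall g u, G g -> f (g *m u) = f u) -> gorbit G u = gorbit G v -> f u = f v.
  move=> finv E; have : gorbit G v u by rewrite -E; exact: gorbit_refl.
  by move=> [g Ggg <-]; rewrite finv.
have kill (f : 'cV[R]_d -> R) : polyfun (fun w => f (vec w)) ->
    (forall g u, G g -> f (g *m u) = f u) -> f x = f y.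
  move=> pf finv; apply/eqP; rewrite -subr_eq0; apply/eqP.
  have [q qE] := polyfunB (polyfun_reindex inl pf) (polyfun_reindex (@inr _ 'I_d) pf).
  rewrite -(qE w); apply: F0 => v E; rewrite qE; apply/eqP; rewrite subr_eq0.
  by apply/eqP/same_orbit.
(* The norm is itself an invariant polynomial, and [separating_invariant] compares orbits on a
   common sphere. *)
have xy : inner x x = inner y y.
  apply: (kill (fun u => inner u u)); first exact: (polyfun_inner R id id).
  by have [oG _ _ _] := Gg; move=> g u Ggg; rewrite inner_orthogonal //; apply: oG.
have [f [pf finv nf]] := separating_invariant Gg (cG y) xy nE.
exact: nf (kill f pf finv).
Qed.

(** * The max filter *)

Section MaxFilter.
Variables (R : realType) (d : nat) (G : set 'M[R]_d).
Hypothesis Gg : orth_group G.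
Implicit Types (x y z p q u v : 'cV[R]_d).

(** Cauchy-Schwarz bounds the set, so that [sup] is a genuine supremum. *)
Lemma has_sup_maxfilt z x :
  has_sup [set inner p q | p in gorbit G z & q in gorbit G x].
Proof.
split; first by exists (inner z x), z; [exact: gorbit_refl|exists x => //; exact: gorbit_refl].
exists (Num.sqrt (inner z z) * Num.sqrt (inner x x)) => _ [p zp [q xq <-]].
apply: le_trans (ler_norm _) _; apply: normr_inner_le; rewrite ?sqrtr_ge0 //.
  by rewrite sqr_sqrtr ?inner_ge0 // (inner_gorbit Gg zp).
by rewrite sqr_sqrtr ?inner_ge0 // (inner_gorbit Gg xq).
Qed.

Lemma maxfilt_ub z x p : gorbit G x p -> inner z p <= maxfilt G z x.
Proof.
move=> xp; apply: sup_ubound; first by case: (has_sup_maxfilt z x).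
by exists z; [exact: gorbit_refl|exists p].
Qed.

(** Only one argument has to run over its orbit, as an orthogonal map can be moved across the inner
    product. The right-hand side is a universal formula, hence accessible to quantifier
    elimination. *)
Lemma maxfilt_le z x t :
  maxfilt G z x <= t <-> forall p, gorbit G x p -> inner z p <= t.
Proof.
split=> [le_t p /(maxfilt_ub z) h|ub]; first exact: le_trans le_t.
apply: ge_sup; first by case: (has_sup_maxfilt z x).
move=> _ [_ [g Ggg <-] [q xq <-]]; rewrite inner_trmx; apply: ub.
by apply: gorbit_stable => //; exact: orth_group_tr.
Qed.

Lemma maxfilt_adherent z x (e : R) : 0 < e ->
  exists2 p, gorbit G x p & maxfilt G z x - e <= inner z p.
Proof.
move=> e0; apply: contrapT => np.
suff : maxfilt G z x <= maxfilt G z x - e by lra.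
apply/maxfilt_le => p xp; apply: contrapT => /negP; rewrite -ltNge => /ltW h.
by apply: np; exists p.
Qed.

Lemma maxfilt_leD z z' x x' (K : R) :
  (forall g, G g -> inner z' (g *m x') <= inner z (g *m x) + K) ->
  maxfilt G z' x' <= maxfilt G z x + K.
Proof.
move=> h; apply/maxfilt_le => _ [g Ggg <-]; apply: le_trans (h g Ggg) _.
by rewrite lerD2r maxfilt_ub //; exists g.
Qed.

Lemma maxfilt_dist_l z z' x (a b : R) : 0 <= a -> 0 <= b ->
  inner (z - z') (z - z') <= a ^+ 2 -> inner x x <= b ^+ 2 ->
  `|maxfilt G z x - maxfilt G z' x| <= a * b.
Proof.
move=> a0 b0 za xb.
have bnd g : G g -> `|inner z (g *m x) - inner z' (g *m x)| <= a * b.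
  have [oG _ _ _] := Gg => Ggg; rewrite -innerBl; apply: normr_inner_le => //.
  by rewrite inner_orthogonal //; apply: oG.
have h1 : maxfilt G z x <= maxfilt G z' x + a * b.
  by apply: maxfilt_leD => g /bnd; rewrite ler_norml => /andP[]; lra.
have h2 : maxfilt G z' x <= maxfilt G z x + a * b.
  by apply: maxfilt_leD => g /bnd; rewrite ler_norml => /andP[]; lra.
by rewrite ler_norml; apply/andP; split; lra.
Qed.

Lemma maxfilt_dist_r z x x' (a b : R) : 0 <= a -> 0 <= b ->
  inner z z <= a ^+ 2 -> inner (x - x') (x - x') <= b ^+ 2 ->
  `|maxfilt G z x - maxfilt G z x'| <= a * b.
Proof.
move=> a0 b0 za xb.
have bnd g : G g -> `|inner z (g *m x) - inner z (g *m x')| <= a * b.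
  have [oG _ _ _] := Gg => Ggg; rewrite -innerBr -mulmxBr; apply: normr_inner_le => //.
  by rewrite inner_orthogonal //; apply: oG.
have h1 : maxfilt G z x <= maxfilt G z x' + a * b.
  by apply: maxfilt_leD => g /bnd; rewrite ler_norml => /andP[]; lra.
have h2 : maxfilt G z x' <= maxfilt G z x + a * b.
  by apply: maxfilt_leD => g /bnd; rewrite ler_norml => /andP[]; lra.
by rewrite ler_norml; apply/andP; split; lra.
Qed.

Lemma gorbitZ (c : R) x : gorbit G (c *: x) = [set c *: p | p in gorbit G x].
Proof.
apply/seteqP; split=> [_ [g Ggg <-]|_ [_ [g Ggg <-] <-]].
  by exists (g *m x); [exists g|rewrite -scalemxAr].
by exists g => //; rewrite -scalemxAr.
Qed.

Lemma maxfiltZ z (c : R) x : 0 < c -> maxfilt G z (c *: x) = c * maxfilt G z x.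
Proof.
move=> c0; apply/eqP; rewrite eq_le; apply/andP; split.
  apply/maxfilt_le => p; rewrite gorbitZ => -[q xq <-].
  by rewrite innerZr ler_pM2l // maxfilt_ub.
rewrite -ler_pdivlMl //; apply/maxfilt_le => p xp; rewrite ler_pdivlMl //.
by rewrite -innerZr maxfilt_ub // gorbitZ; exists p.
Qed.

Lemma semialgebraic_maxfilt_le (K : finType) (a b : 'I_d -> K) (t : K) :
  (forall x, closed (gorbit G x)) ->
  semialgebraic [set w : K -> R | maxfilt G (vec (w \o a)) (vec (w \o b)) <= w t].
Proof.
move=> cG.
pose h (k : 'I_d + 'I_d) : K + 'I_d := match k with inl i => inl (b i) | inr i => inr i end.
have [p pE] := polyfun_inner R (inl \o a) (@inr K 'I_d).
pose P (w : K -> R) (q : 'I_d -> R) := gorbit G (vec (w \o b)) = gorbit G (vec q) ->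
  inner (vec (w \o a)) (vec q) <= w t.
have := semialgebraic_imply (semialgebraic_reindex h (semialgebraic_gorbit Gg cG))
  (semialgebraic_le p (PVar R (inl t))).
move=> sP; have {sP} /(@semialgebraic_forall _ _ _ P) :
    semialgebraic [set v : K + 'I_d -> R | P (v \o inl) (v \o inr)].
  by apply: semialgebraic_ext sP => v; rewrite /P /= pE.
apply: semialgebraic_ext => w; rewrite /P /= maxfilt_le; split=> [H q wq|H q wq].
  have qE : q = vec (fun i => q i 0) by apply/matrixP => i j; rewrite ord1 mxE.
  by rewrite qE; apply: H; rewrite -qE; apply/esym/gorbit_eq.
by apply: H; rewrite wq; exact: gorbit_refl.
Qed.

(** Two reals are equal when they have the same upper bounds [t]; the extra variable [t] is then
    quantified away. *)
Lemma semialgebraic_maxfilt_eq (K : finType) (a b c : 'I_d -> K) :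
  (forall x, closed (gorbit G x)) ->
  semialgebraic [set w : K -> R |
    maxfilt G (vec (w \o a)) (vec (w \o b)) = maxfilt G (vec (w \o a)) (vec (w \o c))].
Proof.
move=> cG.
pose P (w : K -> R) (t : unit -> R) :=
  maxfilt G (vec (w \o a)) (vec (w \o b)) <= t tt <->
  maxfilt G (vec (w \o a)) (vec (w \o c)) <= t tt.
have sP : semialgebraic [set v : K + unit -> R | P (v \o inl) (v \o inr)].
  exact: semialgebraic_iff
    (semialgebraic_maxfilt_le (inl \o a) (inl \o b) (inr tt : K + unit)%type cG)
    (semialgebraic_maxfilt_le (inl \o a) (inl \o c) (inr tt : K + unit)%type cG).
apply: semialgebraic_ext (semialgebraic_forall sP) => w; rewrite /P /=.
split=> [H|-> //]; apply/eqP; rewrite eq_le; apply/andP; split.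
  by have /= [_] := H (fun=> maxfilt G (vec (w \o a)) (vec (w \o c))); apply.
by have /= [+ _] := H (fun=> maxfilt G (vec (w \o a)) (vec (w \o b))); apply.
Qed.

Lemma semialgebraic_confused (n : nat) : (forall x, closed (gorbit G x)) ->
  semialgebraic [set f : 'I_n * 'I_d -> R | exists x y : 'cV[R]_d,
    (forall i, maxfilt G (zvec (mx_coords f) i) x = maxfilt G (zvec (mx_coords f) i) y) /\
    gorbit G x <> gorbit G y].
Proof.
move=> cG.
pose K := ('I_n * 'I_d)%type; pose J := ('I_d + 'I_d)%type.
pose P (f : K -> R) (w : J -> R) :=
  (forall i, i \in enum 'I_n ->
     maxfilt G (vec (f \o pair i)) (vec (w \o inl)) =
     maxfilt G (vec (f \o pair i)) (vec (w \o inr))) /\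
  ~ gorbit G (vec (w \o inl)) = gorbit G (vec (w \o inr)).
have sP : semialgebraic [set v : K + J -> R | P (v \o inl) (v \o inr)].
  apply: semialgebraicI; last first.
    apply: SA_compl; exact: (semialgebraic_reindex inr (semialgebraic_gorbit Gg cG)).
  apply: semialgebraic_all => i.
  exact: (semialgebraic_maxfilt_eq (inl \o pair i) (inr \o inl) (inr \o inr) cG).
have zE f i : zvec (mx_coords f) i = vec (f \o pair i).
  by apply/matrixP => k l; rewrite !mxE.
have vE u : u = vec (fun i => u i 0) by apply/matrixP => i j; rewrite ord1 mxE.
apply: semialgebraic_ext (semialgebraic_ex sP) => f; rewrite /P /=.
split=> [[w [mf nE]]|[x [y [mf nE]]]].
  exists (vec (w \o inl)), (vec (w \o inr)); split=> // i.
  by rewrite zE mf // mem_enum.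
exists (fun k => match k with inl i => x i 0 | inr i => y i 0 end).
rewrite -(vE x) -(vE y); split=> // i _.
by rewrite -zE.
Qed.

End MaxFilter.

(** * Counting confused grid points *)

Definition orbit_gap (R : realType) (d : nat) (G : set 'M[R]_d) (e : R)
    (x y : 'cV[R]_d) : Prop :=
  forall u v, gorbit G x u -> gorbit G y v -> e ^+ 2 <= inner (u - v) (u - v).

(** The unit sphere of the sup norm: one coordinate is a sign and the others range over [-1, 1], so
    cells are counted with exponent D - 1. *)
Definition unit_sup (R : realType) (D : nat) (v : 'cV[R]_D) : Prop :=
  (forall k, `|v k 0| <= 1) /\ exists k, `|v k 0| = 1.

Definition filter_diff (R : realType) (d : nat) (G : set 'M[R]_d)
    (v : 'cV[R]_(d + d)) (z : 'cV[R]_d) : R :=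
  maxfilt G z (usubmx v) - maxfilt G z (dsubmx v).

Lemma inner_delta (R : realType) (d : nat) (j : 'I_d) (p : 'cV[R]_d) :
  inner (delta_mx j 0) p = p j 0.
Proof.
rewrite /inner (bigD1 j) //= big1 ?addr0; first by rewrite mxE !eqxx mul1r.
by move=> i ij; rewrite mxE (negbTE ij) mul0r.
Qed.

(* Maximizers are subgradients of the convex functions [maxfilt G ^~ x] and
   [maxfilt G ^~ y]; as long as they vary little, the difference of the two
   functions is strictly monotone in direction [j]. *)
Lemma near_maximizers_close (R : realType) (d : nat) (G : set 'M[R]_d)
    (x y z z' p p' q q' : 'cV[R]_d) (j : 'I_d) (t a e c : R) :
  orth_group G -> z' = z + t *: delta_mx j 0 ->
  gorbit G x p -> gorbit G x p' -> gorbit G y q -> gorbit G y q' ->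
  maxfilt G z x - a <= inner z p -> maxfilt G z' x - a <= inner z' p' ->
  maxfilt G z y - a <= inner z q -> maxfilt G z' y - a <= inner z' q' ->
  `|p j 0 - p' j 0| <= e / 2 -> `|q j 0 - q' j 0| <= e / 2 ->
  e <= `|p j 0 - q j 0| ->
  `|maxfilt G z x - maxfilt G z y| <= c -> `|maxfilt G z' x - maxfilt G z' y| <= c ->
  `|t| * (e / 2) <= 2 * (a + c).
Proof.
move=> Gg z'E xp xp' yq yq' mp mp' mq mq' pp' qq' epq Fz Fz'.
have shift u : inner z' u = inner z u + t * u j 0.
  by rewrite z'E innerDl innerZl inner_delta.
have h1 : inner z' p <= maxfilt G z' x by exact: maxfilt_ub.
have h2 : inner z p' <= maxfilt G z x by exact: maxfilt_ub.
have h3 : inner z' q <= maxfilt G z' y by exact: maxfilt_ub.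
have h4 : inner z q' <= maxfilt G z y by exact: maxfilt_ub.
rewrite !shift in h1 h3 mp' mq'.
move: Fz Fz'; rewrite !ler_norml => /andP[f1 f2] /andP[f3 f4].
have bnd (s : R) : `|s| <= e / 2 -> t * s <= `|t| * (e / 2).
  move=> se; apply: le_trans (ler_norm _) _.
  by rewrite normrM ler_wpM2l.
have b1 := bnd _ qq'; rewrite -[in X in `|X|]opprB normrN in qq'.
have b2 := bnd _ qq'; have b3 := bnd _ pp'; rewrite -[in X in `|X|]opprB normrN in pp'.
have b4 := bnd _ pp'.
have main : `|t| * `|p j 0 - q j 0| <= `|t| * (e / 2) + 2 * (a + c).
  by rewrite -normrM ler_norml; apply/andP; split; lra.
have : `|t| * e <= `|t| * `|p j 0 - q j 0| by rewrite ler_wpM2l.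
by lra.
Qed.

(** If all coordinates were below [e / d.+1%:R], the norm would be at most [d%:R * (e / d.+1%:R)],
    which is strictly less than [e], also when [d] is 0. *)
Lemma coord_gap (R : realType) (d : nat) (u : 'cV[R]_d) (e : R) :
  0 < e -> e ^+ 2 <= inner u u -> exists j, e / d.+1%:R <= `|u j 0|.
Proof.
move=> e0 eu; apply: contrapT => nj.
have k0 : 0 < e / d.+1%:R by rewrite divr_gt0 ?ltr0n.
have : inner u u <= (d%:R * (e / d.+1%:R)) ^+ 2.
  apply: inner_le_coords; first exact: ltW.
  by move=> j; rewrite leNgt; apply/negP => /ltW h; apply: nj; exists j.
apply/negP; rewrite -ltNge; apply: lt_le_trans eu.
have kE : e / d.+1%:R * d.+1%:R = e by rewrite divfK ?pnatr_eq0.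
rewrite ltrXn2r ?nnegrE ?mulr_ge0 ?(ltW k0) ?(ltW e0) //.
by rewrite -[X in _ < X]kE mulrC ltr_pM2l // ltr_nat.
Qed.

(** With d = d' + 1, the powers of [N] cancel up to the exponent n - (2d - 1), which is at least 1
    exactly because n is at least 2d. *)
Lemma counting_bound (n d' a c N : nat) :
  (0 < N)%N -> (2 * d'.+1 <= n)%N ->
  (N ^ (n * d'.+1) <= c * (3 * N) ^ (d' + d'.+1) * (a * N ^ d') ^ n)%N ->
  (N <= c * 3 ^ (d' + d'.+1) * a ^ n)%N.
Proof.
move=> N0 dn; rewrite !expnMn -expnM => h.
have E : (N ^ (n * d'.+1) = N ^ (n - (d' + d'.+1)) * (N ^ (d' + d'.+1) * N ^ (d' * n)))%N.
  by rewrite -!expnD; congr expn; lia.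
have : (N ^ (n - (d' + d'.+1)) <= c * 3 ^ (d' + d'.+1) * a ^ n)%N.
  rewrite -(@leq_pmul2r (N ^ (d' + d'.+1) * N ^ (d' * n))) ?muln_gt0 ?expn_gt0 ?N0 //.
  by rewrite -E; apply: leq_trans h _; rewrite leq_eqVlt; apply/orP; left; apply/eqP; lia.
apply: leq_trans; rewrite -{1}[N]expn1 leq_pexp2l //; lia.
Qed.

Lemma eq_of_modn_close (C k l : nat) : k = l %[mod C.+1] -> (l - k <= C)%N ->
  (k - l <= C)%N -> k = l.
Proof.
wlog le_kl : k l / (k <= l)%N.
  move=> H E h1 h2; have [kl|/ltnW lk] := leqP k l; first exact: H kl E h1 h2.
  exact/esym/(H _ _ lk (esym E) h2 h1).
move=> /esym/eqP; rewrite eqn_mod_dvd // => + h _.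
move=> /dvdnP[[|m] mE]; first by lia.
by move: h; rewrite mE mulSn; lia.
Qed.

(* Pigeonhole: if every point of a grid of mesh [e0 / N] were confused up to
   [1 / N] by some normalized pair, then the cell of that pair (at most
   [c N^(2d-1)] of them) together with, for each template, the cells of its
   near-maximizers, all its coordinates but one, and the last one modulo a
   constant would determine the grid point, although there are [N^(n d)] grid
   points and [n >= 2 d]. *)
Lemma grid_avoids_confusion (R : realType) (d' n : nat) (G : set 'M[R]_d'.+1)
    (Z0 : 'M[R]_(n, d'.+1)) (e0 e : R) :
  orth_group G -> (2 * d'.+1 <= n)%N -> 0 < e0 -> 0 < e ->
  exists2 Z : 'M[R]_(n, d'.+1), (forall i j, `|Z i j - Z0 i j| < e0) &
    exists2 eta : R, 0 < eta & forall v : 'cV[R]_(d'.+1 + d'.+1),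
      unit_sup v -> orbit_gap G e (usubmx v) (dsubmx v) ->
      exists i, eta <= `|filter_diff G v (zvec Z i)|.
Proof.
move=> Gg dn e00 e0'.
set d := d'.+1 in Z0 *.
apply: contrapT => nZ.
pose M0 : R := e0 + \sum_i \sum_j `|Z0 i j|.
have sumZ0 i j : `|Z0 i j| <= \sum_i \sum_j `|Z0 i j|.
  rewrite (bigD1 i) //= (bigD1 j) //= -addrA lerDl addr_ge0 ?sumr_ge0 // => k _.
  by rewrite sumr_ge0.
have M00 : 0 <= M0.
  by rewrite addr_ge0 ?(ltW e00) // sumr_ge0 // => i _; rewrite sumr_ge0.
pose B : R := d%:R * M0.
have B0 : 0 <= B by rewrite mulr_ge0.
(* The difference of filters is at most 1/N at the confused pair; replacing each of its two vectors
   by that of the cell's representative costs at most B d / N. *)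
pose C1 : R := 1 + 2 * (B * d%:R).
have C10 : 0 < C1 by rewrite ltr_pwDl // mulr_ge0 // mulr_ge0.
pose e1 : R := e / d.+1%:R.
have e10 : 0 < e1 by rewrite divr_gt0 ?ltr0n.
have e12 : 0 < e1 / 2 by rewrite divr_gt0.
pose L := Num.truncn ((d%:R + d%:R) / (e1 / 2)).
(* The conclusion of [near_maximizers_close] with [t] equal to e0 / N times a difference of grid
   indices, both errors being of order 1/N, bounds that difference by [Q]. *)
pose Q : R := 4 * (1 + C1) / (e0 * e1).
have Q0 : 0 <= Q by apply: ltW; rewrite divr_gt0 // mulr_gt0 // addr_gt0.
pose C4 := Num.truncn Q.
(* [A] counts, for one template, the choices of a coordinate, of two maximizer cells and of a
   residue; [c] counts the pivot of the pair and its sign. [N] just exceeds the bound of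
   [counting_bound]. *)
pose A := (d * (L.+1 * L.+1) * C4.+1)%N.
pose c := ((d + d) * 2)%N.
pose N := (c * 3 ^ (d' + d'.+1) * A ^ n).+1.
have N0 : 0 < N%:R :> R by rewrite ltr0n.
have NV0 : 0 < N%:R^-1 :> R by rewrite invr_gt0.
pose h : R := e0 / N%:R.
have h0 : 0 < h by rewrite divr_gt0.
pose K := {ffun 'I_n * 'I_d -> 'I_N}.
pose Zg (k : K) : 'M[R]_(n, d) := \matrix_(i, j) (Z0 i j + h * (k (i, j))%:R).
have Zg_box (k : K) i j : 0 <= h * (k (i, j))%:R < e0.
  rewrite mulr_ge0 ?(ltW h0) //= /h mulrAC ltr_pdivrMr // ltr_pM2l //.
  by rewrite ltr_nat; exact: ltn_ord.
have confused k : exists v : 'cV[R]_(d + d), [/\ unit_sup v,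
    orbit_gap G e (usubmx v) (dsubmx v) &
    forall i, `|filter_diff G v (zvec (Zg k) i)| <= N%:R^-1].
  apply: contrapT => nv; apply: nZ; exists (Zg k).
    move=> i j; rewrite mxE addrAC subrr add0r.
    by have /andP[? ?] := Zg_box k i j; rewrite ger0_norm.
  exists N%:R^-1 => // v uv gv; apply: contrapT => ni; apply: nv; exists v; split=> // i.
  by rewrite leNgt; apply/negP => /ltW hi; apply: ni; exists i.
have [vv vvP] := choice confused.
have pivot k : exists l, `|vv k l 0| = 1 by have [[_]] := vvP k.
have [piv pivP] := choice pivot.
pose mesh (t : R) := cell 1 N%:R^-1 t.
pose delta k := (piv k, 0 <= vv k (piv k) 0,
  [ffun a : 'I_(d' + d'.+1) => mesh (vv k (lift (piv k) a) 0)]).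
have delta_close k k' : delta k = delta k' -> forall l, `|vv k l 0 - vv k' l 0| <= N%:R^-1.
  move=> [Epiv Esgn Ecell] l.
  have [b1 _] : unit_sup (vv k) by have [] := vvP k.
  have [b2 _] : unit_sup (vv k') by have [] := vvP k'.
  case: (unliftP (piv k) l) => [a|] ->.
    move/ffunP/(_ a): Ecell; rewrite !ffunE -Epiv.
    exact: cell_close.
  suff -> : vv k (piv k) 0 = vv k' (piv k) 0 by rewrite subrr normr0 ltW.
  have := pivP k'; rewrite -Epiv in Esgn * => t2; have t1 := pivP k.
  move: Esgn; have [s1|s1] := lerP 0 (vv k (piv k) 0) => /esym.
    by move=> s2; rewrite -(ger0_norm s1) -(ger0_norm s2) t1 t2.
  move=> /negbT; rewrite -ltNge => s2; apply: oppr_inj.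
  by rewrite -(ltr0_norm s1) -(ltr0_norm s2) t1 t2.
pose D := ('I_(d + d) * bool * {ffun 'I_(d' + d'.+1) -> 'I_(Num.truncn ((1 + 1) / N%:R^-1 : R)).+1})%type.
(* One representative pair per cell, so that grid points with the same [delta] are compared through
   the same two orbits. Empty cells get the value 0. *)
have repP (s : D) : exists v : 'cV[R]_(d + d), forall k, delta k = s ->
    [/\ unit_sup v, orbit_gap G e (usubmx v) (dsubmx v) &
        forall l, `|vv k l 0 - v l 0| <= N%:R^-1].
  case: (pselect (exists k, delta k = s)) => [[k ks]|nk]; last first.
    by exists 0 => k ks; case: nk; exists k.
  exists (vv k) => k' k's; have [uk gk _] := vvP k; split=> //.
  by apply: delta_close; rewrite ks.
have [rep {}repP] := choice repP.
have {}repP k := repP (delta k) k erefl.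
pose x k := usubmx (rep (delta k)); pose y k := dsubmx (rep (delta k)).
pose z k i := zvec (Zg k) i.
have zE (k : K) i j : z k i j 0 = Z0 i j + h * (k (i, j))%:R by rewrite !mxE.
have diff_small k i : `|maxfilt G (z k i) (x k) - maxfilt G (z k i) (y k)| <= C1 / N%:R.
  have [_ _ cl] := repP k.
  have [_ _ /(_ i)] := vvP k; rewrite /filter_diff -/(z k i).
  have zB : inner (z k i) (z k i) <= B ^+ 2.
    apply: inner_le_coords => // j; rewrite zE.
    apply: le_trans (ler_normD _ _) _; rewrite addrC lerD //.
    by have /andP[? /ltW ?] := Zg_box k i j; rewrite ger0_norm.
  have dN : 0 <= d%:R * N%:R^-1 :> R by rewrite mulr_ge0 // ltW.
  have dx : `|maxfilt G (z k i) (usubmx (vv k)) - maxfilt G (z k i) (x k)| <= B * (d%:R * N%:R^-1).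
    apply: maxfilt_dist_r => //; apply: inner_le_coords; first exact: ltW.
    by move=> j; rewrite !mxE; exact: cl.
  have dy : `|maxfilt G (z k i) (dsubmx (vv k)) - maxfilt G (z k i) (y k)| <= B * (d%:R * N%:R^-1).
    apply: maxfilt_dist_r => //; apply: inner_le_coords; first exact: ltW.
    by move=> j; rewrite !mxE; exact: cl.
  move: dx dy; rewrite /C1 !ler_norml => /andP[x1 x2] /andP[y1 y2] /andP[v1 v2].
  by apply/andP; split; lra.
have maximizers (ki : K * 'I_n) : exists pqj : 'cV[R]_d * 'cV[R]_d * 'I_d,
    let: (p, q, j) := pqj in let: (k, i) := ki in
    [/\ gorbit G (x k) p, gorbit G (y k) q,
        maxfilt G (z k i) (x k) - N%:R^-1 <= inner (z k i) p,
        maxfilt G (z k i) (y k) - N%:R^-1 <= inner (z k i) q &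
        e1 <= `|p j 0 - q j 0|].
  case: ki => k i; have [_ gap _] := repP k.
  have [p xp mp] := maxfilt_adherent Gg (z k i) (x k) NV0.
  have [q yq mq] := maxfilt_adherent Gg (z k i) (y k) NV0.
  have [j ej] := coord_gap e0' (gap p q xp yq).
  by exists (p, q, j); split=> //; move: ej; rewrite !mxE.
have [pqj {}maximizers] := choice maximizers.
pose p k i := (pqj (k, i)).1.1; pose q k i := (pqj (k, i)).1.2; pose jj k i := (pqj (k, i)).2.
have {}maximizers k i : [/\ gorbit G (x k) (p k i), gorbit G (y k) (q k i),
        maxfilt G (z k i) (x k) - N%:R^-1 <= inner (z k i) (p k i),
        maxfilt G (z k i) (y k) - N%:R^-1 <= inner (z k i) (q k i) &
        e1 <= `|p k i (jj k i) 0 - q k i (jj k i) 0|].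
  by have := maximizers (k, i); rewrite /p /q /jj; case: (pqj (k, i)) => [[]].
pose theta k i := (jj k i, (cell d%:R (e1 / 2) (p k i (jj k i) 0), cell d%:R (e1 / 2) (q k i (jj k i) 0)),
  [ffun a : 'I_d' => k (i, lift (jj k i) a)], inord (k (i, jj k i) %% C4.+1) : 'I_C4.+1).
pose Phi k := (delta k, [ffun i => theta k i]).
have coord_bound (w : 'cV[R]_(d + d)) u j : unit_sup w ->
    (gorbit G (usubmx w) u \/ gorbit G (dsubmx w) u) -> `|u j 0| <= d%:R.
  move=> [w1 _] hu; apply: coord_le_inner => //; rewrite -[d%:R]mulr1.
  by case: hu => /(inner_gorbit Gg) ->; apply: inner_le_coords => // l; rewrite mxE.
have Phi_inj : injective Phi.
  move=> k k' E; have Edelta : delta k = delta k' := congr1 fst E.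
  have /ffunP Etheta := congr1 snd E.
  apply/ffunP => -[i j].
  have := Etheta i; rewrite !ffunE => -[Ej Ep Eq Ek Em].
  have {}Ek a : k (i, lift (jj k i) a) = k' (i, lift (jj k i) a).
    by move/ffunP/(_ a): Ek; rewrite !ffunE -Ej.
  case: (unliftP (jj k i) j) => [a ->|->]; first exact: Ek.
  set j0 := jj k i in Ej Ep Eq Ek Em *.
  have [uw _ _] := repP k.
  have [xp yq mp mq epq] := maximizers k i.
  have [xp' yq' mp' mq' _] := maximizers k' i.
  rewrite -/j0 in epq; rewrite -Ej in Ep Eq Em.
  have Ex : x k' = x k by rewrite /x Edelta.
  have Ey : y k' = y k by rewrite /y Edelta.
  rewrite Ex in xp' mp'; rewrite Ey in yq' mq'.
  have s1 := diff_small k i; have := diff_small k' i; rewrite Ex Ey => s2.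
  pose t := h * ((k' (i, j0))%:R - (k (i, j0))%:R).
  (* The grid indices agree off [j0], so the two templates differ along a single basis vector. *)
  have zz : z k' i = z k i + t *: delta_mx j0 0.
    apply/matrixP => l l'; rewrite ord1 !mxE eqxx andbT.
    case: (unliftP j0 l) => [a ->|->]; last first.
      by rewrite eqxx mulr1n /t; ring.
    by rewrite Ek eq_sym (negbTE (neq_lift _ _)) mulr0n mulr0 addr0.
  have pp : `|p k i j0 0 - p k' i j0 0| <= e1 / 2.
    by apply: cell_close Ep => //; apply: (coord_bound (rep (delta k))) => //; left.
  have qq : `|q k i j0 0 - q k' i j0 0| <= e1 / 2.
    by apply: cell_close Eq => //; apply: (coord_bound (rep (delta k))) => //; right.
  have := near_maximizers_close Gg zz xp xp' yq yq' mp mp' mq mq' pp qq epq s1 s2.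
  rewrite /t normrM (ger0_norm (ltW h0)) => small.
  have close : `|(k' (i, j0))%:R - (k (i, j0))%:R| <= Q :> R.
    rewrite /Q ler_pdivlMr ?mulr_gt0 //.
    move: small; rewrite /h; set T := `|_| => small.
    have : e0 / N%:R * T * (e1 / 2) * N%:R <= 2 * (N%:R^-1 + C1 / N%:R) * N%:R by rewrite ler_pM2r.
    have -> : e0 / N%:R * T * (e1 / 2) * N%:R = e0 * T * (e1 / 2) by field; rewrite gt_eqF.
    have -> : 2 * (N%:R^-1 + C1 / N%:R) * N%:R = 2 * (1 + C1) by field; rewrite gt_eqF.
    by lra.
  have natdist (a b : nat) : `|a%:R - b%:R| <= Q -> (a - b <= C4)%N.
    move=> ab; rewrite truncn_ge_nat //; have [le_ab|/ltnW le_ba] := leqP a b.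
      by move: le_ab; rewrite -subn_eq0 => /eqP ->.
    by rewrite natrB // (le_trans (ler_norm _)).
  apply: val_inj; apply: (@eq_of_modn_close C4).
  - by move/(congr1 val): Em; rewrite /= !inordK // ltn_mod.
  - exact: natdist.
  - by apply: natdist; rewrite distrC.
have := leq_card Phi Phi_inj.
rewrite !(card_prod, card_ffun, card_ord, card_bool) -/d -/L -/N => hcard.
(* There are 2N + 1 cells of length 1/N on [-1, 1], hence at most 3N. *)
have trN : (Num.truncn ((1 + 1) / N%:R^-1 : R)).+1 = (2 * N).+1.
  by rewrite invrK -[1 + 1]/(2%:R) -natrM natrK.
suff : (N <= c * 3 ^ (d' + d'.+1) * A ^ n)%N by rewrite ltnn.
apply: counting_bound => //; apply: leq_trans hcard _.
rewrite trN -/c; apply: leq_mul; first by rewrite leq_mul // leq_exp2r //; lia.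
by rewrite leq_eqVlt; apply/orP; left; apply/eqP; congr expn; rewrite /A; lia.
Qed.

(** * Empty interior and the theorem *)

Lemma filter_diff_dist (R : realType) (d : nat) (G : set 'M[R]_d) (v : 'cV[R]_(d + d))
    (z z' : 'cV[R]_d) (k : R) :
  orth_group G -> 0 <= k -> unit_sup v -> (forall j, `|z j 0 - z' j 0| <= k) ->
  `|filter_diff G v z - filter_diff G v z'| <= 2 * (d%:R * k * d%:R).
Proof.
move=> Gg k0 [v1 _] zz.
have za : inner (z - z') (z - z') <= (d%:R * k) ^+ 2.
  by apply: inner_le_coords => // j; rewrite !mxE.
have ub : inner (usubmx v) (usubmx v) <= d%:R ^+ 2.
  by rewrite -[d%:R]mulr1; apply: inner_le_coords => // j; rewrite mxE.
have db : inner (dsubmx v) (dsubmx v) <= d%:R ^+ 2.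
  by rewrite -[d%:R]mulr1; apply: inner_le_coords => // j; rewrite mxE.
have dk0 : 0 <= d%:R * k by rewrite mulr_ge0.
have := maxfilt_dist_l Gg dk0 (ler0n _ _) za ub.
have := maxfilt_dist_l Gg dk0 (ler0n _ _) za db.
rewrite /filter_diff !ler_norml => /andP[? ?] /andP[? ?].
by apply/andP; split; lra.
Qed.

(** Dividing by the sup norm of the stacked pair, nonzero as the orbits differ, loses nothing
    because max filters are positively homogeneous. The gap is rounded down to some 1/(m + 1) to
    leave countably many cases for Baire's theorem. *)
Lemma normalize_confused (R : realType) (d : nat) (G : set 'M[R]_d) (x y : 'cV[R]_d) :
  orth_group G -> closed (gorbit G y) -> gorbit G x <> gorbit G y ->
  exists (m : nat) (c : R), [/\ 0 < c, unit_sup (col_mx (c *: x) (c *: y)) &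
    orbit_gap G m.+1%:R^-1 (c *: x) (c *: y)].
Proof.
move=> Gg cy nxy; pose w := col_mx x y.
have [k0 wk0] : exists k, w k 0 != 0.
  apply: contrapT => /forallNP w0; apply: nxy; suff -> : x = y by [].
  have {}w0 k : w k 0 = 0 by apply/eqP/negPn/negP/w0.
  apply/matrixP => i j; rewrite ord1.
  by have := w0 (lshift d i); have := w0 (rshift d i); rewrite /w col_mxEu col_mxEd => -> ->.
pose km := [arg max_(k > k0) `|w k 0|]%O.
have kmP k : `|w k 0| <= `|w km 0|.
  by rewrite /km; case: arg_maxP => // l _; apply.
have wkm : 0 < `|w km 0| by apply: lt_le_trans (kmP k0); rewrite normr_gt0.
pose c := `|w km 0|^-1; have c0 : 0 < c by rewrite invr_gt0.
have [e e0 gap] := gorbit_separated Gg cy nxy.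
have ce0 : 0 < c * e by rewrite mulr_gt0.
exists (Num.truncn (c * e)^-1), c; split=> //.
  rewrite -scale_col_mx -/w; split=> [k|].
    by rewrite mxE normrM (ger0_norm (ltW c0)) ler_pdivrMl // mulr1.
  exists km; rewrite mxE normrM (ger0_norm (ltW c0)) mulVf //; exact: lt0r_neq0.
move=> _ _ [g Ggg <-] [h Gh <-]; rewrite -!scalemxAr -scalerBr innerZl innerZr mulrA -expr2.
apply: (@le_trans _ _ ((c * e) ^+ 2)).
  rewrite lerXn2r ?nnegrE ?(ltW ce0) // ?invr_ge0 ?ler0n //.
  rewrite -[leRHS]invrK lef_pV2 ?posrE ?invr_gt0 ?ltr0n //.
  by apply/ltW/truncnS_gt.
by rewrite exprMn ler_pM2l ?exprn_gt0 //; apply: gap; [exists g|exists h].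
Qed.

HB.instance Definition _ (R : realType) (m n : nat) := NormedModule.on 'M[R]_(m, n).

Lemma confused_empty_interior (R : realType) (d' n : nat) (G : set 'M[R]_d'.+1)
    (Z0 : 'M[R]_(n, d'.+1)) (e0 : R) :
  orth_group G -> (forall x, closed (gorbit G x)) -> (2 * d'.+1 <= n)%N -> 0 < e0 ->
  exists2 Z : 'M[R]_(n, d'.+1), (forall i j, `|Z i j - Z0 i j| < e0) &
    forall x y, (forall i, maxfilt G (zvec Z i) x = maxfilt G (zvec Z i) y) ->
      gorbit G x = gorbit G y.
Proof.
move=> Gg cG dn e00.
(* Up to scaling, every confused tuple lies in some [bad m]. The interior of each complement is
   dense: near any tuple there is one with a gap [eta] uniform over the normalized pairs, and such a
   gap persists under small perturbations. *)
pose bad (m : nat) : set 'M[R]_(n, d'.+1) := [set Z | exists v : 'cV[R]_(d'.+1 + d'.+1),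
  [/\ unit_sup v, orbit_gap G m.+1%:R^-1 (usubmx v) (dsubmx v) &
      forall i, filter_diff G v (zvec Z i) = 0]].
have odO m : open (~` bad m)° /\ dense (~` bad m)°.
  split; first exact: open_interior.
  move=> O [Z1 OZ1] oO.
  have /nbhs_ballP[e /= e_gt0 ballO] : nbhs Z1 O by apply: open_nbhs_nbhs; split.
  have mV0 : 0 < m.+1%:R^-1 :> R by rewrite invr_gt0 ltr0n.
  have [Z ZZ1 [eta eta0 etaP]] := grid_avoids_confusion Z1 Gg dn e_gt0 mV0.
  exists Z; split.
    apply: ballO; split=> // i j; rewrite /ball /= distrC; exact: ZZ1.
  set d := d'.+1 in Gg cG dn Z etaP bad ZZ1 *.
  (* By [filter_diff_dist], moving the entries by [del] changes the difference of filters by at most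
     eta/2. *)
  pose del := eta / (4 * (d%:R * d%:R)).
  have del0 : 0 < del by rewrite divr_gt0 // !mulr_gt0 // ltr0n.
  apply/nbhs_ballP; exists del => //= Z' [_ ZZ'] [v [uv gv Fv]].
  have [i etai] := etaP v uv gv.
  have : `|filter_diff G v (zvec Z i) - filter_diff G v (zvec Z' i)| <= 2 * (d%:R * del * d%:R).
    apply: filter_diff_dist => //; first exact: ltW.
    by move=> j; rewrite !mxE; apply: ltW; exact: ZZ'.
  rewrite Fv subr0 => /(le_trans etai).
  have -> : 2 * (d%:R * del * d%:R) = eta / 2.
    by rewrite /del; field; rewrite pnatr_eq0.
  by lra.
have [] := @Baire R 'M[R]_(n, d'.+1) (fun m => (~` bad m)°) odO (ball Z0 e0).
- by exists Z0; apply: ballxx.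
- exact: ball_open.
move=> Z [[_ ZZ0] Zgood]; exists Z.
  by move=> i j; rewrite distrC; exact: ZZ0.
move=> x y mf; apply: contrapT => nxy.
have [m [c [c0 uc gc]]] := normalize_confused Gg (cG y) nxy.
have /interior_subset := Zgood m I; apply.
exists (col_mx (c *: x) (c *: y)); rewrite col_mxKu col_mxKd; split=> // i.
by rewrite /filter_diff col_mxKu col_mxKd !maxfiltZ // mf subrr.
Qed.

Lemma nonclosed_orbit_not_injective (R : realType) (d : nat) (G : set 'M[R]_d)
    (x : 'cV[R]_d) (Y : topologicalType) (f : 'cV[R]_d -> Y) :
  orth_group G -> ~ closed (gorbit G x) -> accessible_space Y ->
  (forall x y, gorbit G x = gorbit G y -> f x = f y) -> continuous f ->
  exists x y, f x = f y /\ gorbit G x <> gorbit G y.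
Proof.
move=> Gg ncl T1 finv cf.
have [y [cly nxy]] : exists y, closure (gorbit G x) y /\ ~ gorbit G x y.
  apply: contrapT => /forallNP ny; apply: ncl => y cly.
  by apply: contrapT => nxy; apply: (ny y).
exists x, y; split; last by move=> E; apply: nxy; rewrite E; apply: gorbit_refl.
have cl1 : closed (f @^-1` [set f x]).
  by apply: closed_comp => [z _|]; [exact: cf|exact: accessible_closed_set1].
suff : (f @^-1` [set f x]) y by move=> /= ->.
apply: cl1; apply: closure_subset cly => _ [g Ggg <-] /=; apply: finv.
by apply: gorbit_eq => //; exists g.
Qed.

Lemma maxfilt_spheres (R : realType) (d : nat) (G : set 'M[R]_d) (z x : 'cV[R]_d) :
  orth_group G -> (forall x, gorbit G x = [set y | inner y y = inner x x]) -> z != 0 ->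
  maxfilt G z x = Num.sqrt (inner z z) * Num.sqrt (inner x x).
Proof.
move=> Gg sph z0; have zz := inner_gt0 z0.
set a := Num.sqrt (inner z z); set b := Num.sqrt (inner x x).
have a0 : 0 < a by rewrite sqrtr_gt0.
have a2 : a ^+ 2 = inner z z by rewrite sqr_sqrtr // ltW.
have b2 : b ^+ 2 = inner x x by rewrite sqr_sqrtr // inner_ge0.
apply/eqP; rewrite eq_le; apply/andP; split.
  apply/maxfilt_le => // p; rewrite sph /= => pE.
  apply: le_trans (ler_norm _) _; apply: normr_inner_le; rewrite ?sqrtr_ge0 //.
    by rewrite a2.
  by rewrite pE b2.
(* The Cauchy-Schwarz bound is attained at the multiple of [z] with the norm of [x], which lies on
   the orbit of [x]. *)
have -> : a * b = inner z ((b / a) *: z) by rewrite innerZr -a2; field; rewrite gt_eqF.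
apply: maxfilt_ub => //; rewrite sph /= innerZl innerZr -a2 -b2; field.
by rewrite gt_eqF.
Qed.

(** Only the full index set has n d elements, so the dimension bound says that the set itself has
    empty interior. *)
Lemma dim_lt_confused (R : realType) (d n : nat) (G : set 'M[R]_d) :
  orth_group G -> (forall x, closed (gorbit G x)) -> (2 * d <= n)%N ->
  dim_lt [set f : 'I_n * 'I_d -> R | exists x y : 'cV[R]_d,
    (forall i, maxfilt G (zvec (mx_coords f) i) x = maxfilt G (zvec (mx_coords f) i) y) /\
    gorbit G x <> gorbit G y] (n * d).
Proof.
move=> Gg cG dn J cardJ [f [e e0 fJ]].
have {cardJ} JT : J = [set: 'I_n * 'I_d]%SET.
  by apply/eqP; rewrite eqEcard finset.subsetT cardsT card_prod !card_ord.
(* For d = 0 there is only one vector, hence no pair of distinct orbits. *)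
case: d => [|d'] in G Gg cG dn J f fJ JT *.
  have [|s [x [y [_ nxy]]] _] := fJ f; first by move=> i _; rewrite subrr normr0.
  by apply: nxy; congr gorbit; apply/matrixP => -[].
have [Z ZZ0 Zgood] := confused_empty_interior (mx_coords f) Gg cG dn e0.
have [|s [x [y [mf nxy]]] sZ] := fJ (fun ij => Z ij.1 ij.2).
  by move=> [i j] _; have := ZZ0 i j; rewrite mxE.
have sE : mx_coords s = Z by apply/matrixP => i j; rewrite mxE sZ // JT inE.
by apply: nxy; apply: Zgood => i; rewrite -sE.
Qed.

Unset Implicit Arguments.

Theorem theorem5 (R : realType) (d : nat) (G : set 'M[R]_d) :
  orth_group G ->
  (* (a) maps from R^d/G are identified with G-invariant maps on R^d;
     continuity for the quotient topology = continuity of the lift *)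
  [/\ ((exists x, ~ closed (gorbit G x)) ->
       forall (Y : topologicalType) (f : 'cV[R]_d -> Y),
         @accessible_space Y ->
         (forall x y, gorbit G x = gorbit G y -> f x = f y) ->
         continuous f ->
         exists x y, f x = f y /\ gorbit G x <> gorbit G y),
      ((forall x, gorbit G x = [set y | inner y y = inner x x]) ->
       forall z : 'cV[R]_d, z != 0 ->
         forall x y, maxfilt G z x = maxfilt G z y -> gorbit G x = gorbit G y) &
      ((forall x, closed (gorbit G x)) ->
       forall n : nat, (2 * d <= n)%N ->
         generic (fun Z : 'M[R]_(n, d) =>
           forall x y, (forall i, maxfilt G (zvec Z i) x = maxfilt G (zvec Z i) y) ->
             gorbit G x = gorbit G y))].
Proof.
move=> Gg; split.
- by move=> [x ncl] Y f; apply: nonclosed_orbit_not_injective ncl.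
- move=> sph z z0 x y; rewrite !maxfilt_spheres // => /mulfI E.
  have /E : Num.sqrt (inner z z) != 0 by rewrite gt_eqF // sqrtr_gt0 inner_gt0.
  move=> /(congr1 (fun t => t ^+ 2)); rewrite !sqr_sqrtr ?inner_ge0 // => E2.
  by rewrite !sph E2.
move=> cG n dn.
exists [set f : 'I_n * 'I_d -> R | exists x y : 'cV[R]_d,
    (forall i, maxfilt G (zvec (mx_coords f) i) x = maxfilt G (zvec (mx_coords f) i) y) /\
    gorbit G x <> gorbit G y]; split.
- exact: semialgebraic_confused.
- exact: dim_lt_confused.
- move=> f nf x y mf; apply: contrapT => nxy; apply: nf.
  by exists x, y.
Qed.
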